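(* Let $N\ge2$, $\alpha_1,\alpha_2\in(0,1)$, and let $B_1$ be the open unit ball of $\mathbb{R}^N$ centered at the origin. Let $f_1,f_2:[0,\infty)\to\mathbb{R}$ be locally Lipschitz continuous and increasing functions, and let $g_1,g_2:B_1\to\mathbb{R}$ be radially symmetric and decreasing in $|x|$. If $(u,v)$ are positive classical solutions of the system $$\begin{cases}(-\Delta)^{\alpha_1}u=f_1(v)+g_1 & \text{in } B_1,\\ (-\Delta)^{\alpha_2}v=f_2(u)+g_2 & \text{in } B_1,\\ u=v=0 & \text{in } B_1^c=\mathbb{R}^N\setminus B_1,\end{cases}$$ then $u$ and $v$ are radially symmetric and strictly decreasing in $r=|x|$ for $r\in(0,1)$.
   Context: For $\alpha\in(0,1)$ the fractional Laplacian is $$(-\Delta)^\alpha u(x)=P.V.\int_{\mathbb{R}^N}\frac{u(x)-u(y)}{|x-y|^{N+2\alpha}}\,dy,$$ where $P.V.$ denotes the principal value at $y=x$. A classical solution $(u,v)$ consists of continuous functions $u,v:\mathbb{R}^N\to\mathbb{R}$ such that $(-\Delta)^{\alpha_1}u(x)$ and $(-\Delta)^{\alpha_2}v(x)$ are defined by this formula at every $x\in B_1$ and such that the equations in $B_1$ and the conditions in $B_1^c$ hold pointwise. Positive means $u>0$ and $v>0$ in $B_1$. ''Increasing'' and ''decreasing'' without the word ''strictly'' are understood in the non-strict sense. *)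

(* Defs.v *)
From HB Require Import structures.
From mathcomp Require Import all_boot all_order all_algebra.
From mathcomp Require Import all_classical all_reals all_analysis.
Set Implicit Arguments.
Unset Strict Implicit.
Unset Printing Implicit Defensive.
Import Order.TTheory GRing.Theory Num.Theory.
Import numFieldNormedType.Exports.
Local Open Scope classical_set_scope.
Local Open Scope ring_scope.

(* The product sigma-algebra on row vectors, following the library's instance
   for [n.-tuple T]. For T = R it is the Borel sigma-algebra. *)
Section measurable_rV.
Context {d} {T : sigmaRingType d}.
Variable n : nat.

Let coors : 'I_n -> 'rV[T]_n -> T := fun i x => x ord0 i.

Let rV_set0 : g_sigma_preimage coors set0.
Proof. exact: sigma_algebra0. Qed.

Let rV_setC A : g_sigma_preimage coors A -> g_sigma_preimage coors (~` A).
Proof. exact: sigma_algebraC. Qed.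

Let rV_bigcup (F : _^nat) : (forall i, g_sigma_preimage coors (F i)) ->
  g_sigma_preimage coors (\bigcup_i (F i)).
Proof. exact: sigma_algebra_bigcup. Qed.

HB.instance Definition _ := @isMeasurable.Build (measure_tuple_display d)
  'rV[T]_n (g_sigma_preimage coors) rV_set0 rV_setC rV_bigcup.

End measurable_rV.

Lemma measurable_coord d (T : sigmaRingType d) n (i : 'I_n) :
  measurable_fun [set: 'rV[T]_n] (fun x : 'rV[T]_n => x ord0 i).
Proof.
move=> _ Y mY; rewrite setTI; apply: sub_sigma_algebra => /=.
rewrite -bigcup_seq/=; exists i => /=; first by rewrite mem_index_enum.
by exists Y => //; rewrite setTI.
Qed.

Lemma measurable_fun_rVP d1 d2 (T1 : measurableType d1) (T2 : measurableType d2)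
    n (f : T1 -> 'rV[T2]_n) :
  measurable_fun [set: T1] f <->
  forall i, measurable_fun [set: T1] (fun x => f x ord0 i).
Proof.
split=> [mf i|mf].
  apply: (@measurableT_comp _ _ _ _ _ _ (fun x : 'rV[T2]_n => x ord0 i)) => //.
  exact: measurable_coord.
move=> _ A mA; rewrite setTI.
suff : @measurable _ 'rV[T2]_n `<=` image_set_system setT f measurable.
  by move=> /(_ A mA); rewrite /image_set_system/= setTI.
apply: smallest_sub; first exact/sigma_algebra_image/sigma_algebra_measurable.
move=> B; rewrite -bigcup_seq => -[i _ [C mC <-]].
by rewrite /image_set_system/= !setTI -[_ @^-1` _]setTI; exact: mf.
Qed.

Section lebesgue_rV.
Context {R : realType}.

Definition cons_rV n (p : measurableTypeR R * 'rV[R]_n) : 'rV[R]_n.+1 :=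
  row_mx (const_mx p.1 : 'rV_1) p.2.

Definition lebesgue_rV_cons n (m : set 'rV[R]_n -> \bar R) :
    set 'rV[R]_n.+1 -> \bar R :=
  pushforward (lebesgue_measure \x m)%E (@cons_rV n).

(* Lebesgue measure on R^n, as the n-fold product of [lebesgue_measure];
   R^0 is a point of mass 1. *)
Fixpoint lebesgue_rV n : set 'rV[R]_n -> \bar R :=
  match n with
  | 0 => \d_(0 : 'rV[R]_0)
  | m.+1 => lebesgue_rV_cons (@lebesgue_rV m)
  end.

Let uncons_rV n (x : 'rV[R]_n.+1) : measurableTypeR R * 'rV[R]_n :=
  (x ord0 ord0, \row_(j < n) x ord0 (lift ord0 j)).

Let cons_rVK n : cancel (@cons_rV n) (@uncons_rV n).
Proof.
move=> [a x]; rewrite /uncons_rV /cons_rV; congr pair.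
  transitivity (row_mx (const_mx a : 'rV[R]_1) x ord0 (lshift n ord0)).
    by congr (row_mx _ _ _ _); exact/val_inj.
  by rewrite row_mxEl mxE.
apply/rowP => j; rewrite mxE.
transitivity (row_mx (const_mx a : 'rV[R]_1) x ord0 (rshift 1 j)).
  by congr (row_mx _ _ _ _); exact/val_inj.
by rewrite row_mxEr.
Qed.

Let measurable_cons_rV n : measurable_fun setT (@cons_rV n).
Proof.
apply/measurable_fun_rVP => i; rewrite /cons_rV.
case: (@split_ordP 1 n i) => j ->.
- rewrite (_ : (fun p => _) = fst); first exact: measurable_fst.
  by apply/funext => p; rewrite [LHS](@row_mxEl _ _ _ _ _ p.2) mxE.
- rewrite (_ : (fun p => _) =
      fun p : measurableTypeR R * 'rV[R]_n => p.2 ord0 j).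
    apply: (@measurableT_comp _ _ _ _ _ _ (fun x : 'rV[R]_n => x ord0 j)) => //.
    exact: measurable_coord.
  by apply/funext => p; rewrite [LHS](@row_mxEr _ _ _ _ (const_mx p.1)).
Qed.

Let measurable_uncons_rV n : measurable_fun setT (@uncons_rV n).
Proof.
apply/measurable_fun_pair => /=; first exact: measurable_coord.
apply/measurable_fun_rVP => j; under eq_fun do rewrite mxE.
exact: measurable_coord.
Qed.

Section lebesgue_rV_cons.
Variables (n : nat) (m : {sigma_finite_measure set 'rV[R]_n -> \bar R}).

Let l := lebesgue_rV_cons m.

Let l0 : l set0 = 0%E.
Proof. by rewrite /l /lebesgue_rV_cons /pushforward preimage_set0 measure0. Qed.

Let l_ge0 A : (0 <= l A)%E.
Proof. by rewrite /l /lebesgue_rV_cons /pushforward; exact: measure_ge0. Qed.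

Let l_sigma_additive : semi_sigma_additive l.
Proof.
have mcons := @measurable_cons_rV n.
exact: measure_semi_sigma_additive.
Qed.

HB.instance Definition _ := isMeasure.Build _ _ _ (lebesgue_rV_cons m)
  l0 l_ge0 l_sigma_additive.

Let l_sigma_finite : sigma_finite setT l.
Proof.
have /sigma_finiteP[F [FT ndF Foo]] := sigma_finiteT (@lebesgue_measure R).
have /sigma_finiteP[G [GT ndG Goo]] := sigma_finiteT m.
exists (fun k => @uncons_rV n @^-1` (F k `*` G k)).
  rewrite -preimage_bigcup (_ : \bigcup_k _ = setT) ?preimage_setT//.
  rewrite -setXTT FT GT predeqE => -[a x]; split=> [[k _ []/= ? ?]|].
    by split; exists k.
  move=> [/= [k _ Fka] [p _ Gpx]]; exists (maxn k p) => //; split.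
  - by move: a Fka; exact/subsetPset/ndF/leq_maxl.
  - by move: x Gpx; exact/subsetPset/ndG/leq_maxr.
move=> k; have [mF Fk] := Foo k; have [mG Gk] := Goo k; split.
  rewrite -[_ @^-1` _]setTI; apply: measurable_uncons_rV => //.
  exact: measurableX.
rewrite /l /lebesgue_rV_cons /pushforward -comp_preimage.
rewrite (_ : _ \o _ = id); last first.
  exact/funext/cons_rVK.
by rewrite preimage_id product_measure1E// lte_mul_pinfty// ge0_fin_numE.
Qed.

HB.instance Definition _ := Measure_isSigmaFinite.Build _ _ _ (lebesgue_rV_cons m)
  l_sigma_finite.

End lebesgue_rV_cons.

Let lebesgue_rV_ex n : exists m : {sigma_finite_measure set 'rV[R]_n -> \bar R},
  @lebesgue_rV n = m.
Proof.
elim: n => [|n [m mE]]; first by exists \d_(0 : 'rV[R]_0).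
by rewrite /= mE; exists (lebesgue_rV_cons m).
Qed.

Variable n : nat.

Let lebesgue_rV0 : @lebesgue_rV n set0 = 0%E.
Proof. by have [m ->] := lebesgue_rV_ex n; exact: measure0. Qed.

Let lebesgue_rV_ge0 A : (0 <= @lebesgue_rV n A)%E.
Proof. by have [m ->] := lebesgue_rV_ex n; exact: measure_ge0. Qed.

Let lebesgue_rV_sigma_additive : semi_sigma_additive (@lebesgue_rV n).
Proof.
by have [m ->] := lebesgue_rV_ex n; exact: measure_semi_sigma_additive.
Qed.

HB.instance Definition _ := isMeasure.Build _ _ _ (@lebesgue_rV n)
  lebesgue_rV0 lebesgue_rV_ge0 lebesgue_rV_sigma_additive.

Let lebesgue_rV_sigma_finite : sigma_finite setT (@lebesgue_rV n).
Proof. by have [m ->] := lebesgue_rV_ex n; exact: sigma_finiteT. Qed.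

HB.instance Definition _ := Measure_isSigmaFinite.Build _ _ _ (@lebesgue_rV n)
  lebesgue_rV_sigma_finite.

End lebesgue_rV.
Arguments lebesgue_rV {R} n.

Section fractional_laplacian.
Context {R : realType} {N : nat}.
Implicit Types (x y : 'rV[R]_N) (w : 'rV[R]_N -> R) (A : set 'rV[R]_N).

(* The library's norm on row vectors is the sup norm. *)
Definition enorm x : R := Num.sqrt (\sum_(i < N) x ord0 i ^+ 2).

Definition unit_ball : set 'rV[R]_N := [set x | enorm x < 1].

Definition fraclap_integrand (alpha : R) w x y : R :=
  (w x - w y) / enorm (x - y) `^ (N%:R + 2 * alpha).

(* [is_fraclap alpha w x l]: the principal value defining
   (-Delta)^alpha w (x) exists and equals l. *)
Definition is_fraclap (alpha : R) w x (l : R) : Prop :=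
  (forall e, 0 < e -> (lebesgue_rV N).-integrable [set y | e <= enorm (x - y)]
    (fun y => (fraclap_integrand alpha w x y)%:E)) /\
  (\int[lebesgue_rV N]_(y in [set y | e <= enorm (x - y)])
      fraclap_integrand alpha w x y) @[e --> 0^'+] --> l.

Definition radially_symmetric_on A w : Prop :=
  {in A &, forall x y, enorm x = enorm y -> w x = w y}.

Definition radially_decreasing_on A w : Prop :=
  {in A &, forall x y, enorm x <= enorm y -> w y <= w x}.

Definition radially_strictly_decreasing_on A w : Prop :=
  {in A &, forall x y, enorm x < enorm y -> w y < w x}.

Definition classical_solution (alpha1 alpha2 : R) (f1 f2 : R -> R)
    (g1 g2 u v : 'rV[R]_N -> R) : Prop :=
  [/\ continuous u /\ continuous v,
      forall x, unit_ball x -> is_fraclap alpha1 u x (f1 (v x) + g1 x),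
      forall x, unit_ball x -> is_fraclap alpha2 v x (f2 (u x) + g2 x) &
      forall x, ~ unit_ball x -> u x = 0 /\ v x = 0].

End fractional_laplacian.

(* Main.v *)
Require Import Defs.
From HB Require Import structures.
From mathcomp Require Import all_boot all_order all_algebra.
From mathcomp Require Import all_classical all_reals all_analysis.
From mathcomp Require Import measurable_realfun.
From mathcomp Require Import ring lra.
Set Implicit Arguments.
Unset Strict Implicit.
Unset Printing Implicit Defensive.
Import Order.TTheory GRing.Theory Num.Theory.
Import numFieldNormedType.Exports.
Local Open Scope classical_set_scope.
Local Open Scope ring_scope.

(** The proof is the method of moving planes. For a unit vector [e] and
    [0 < l < 1], let [refl e l] be the reflection in the hyperplane
    [x.e = l], let Sigma be the half-space [x.e > l], and let
    [gap e l u x = u (refl e l x) - u x]. Everything follows from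
    [gap e l u >= 0] and [gap e l v >= 0] on Sigma for all [e] and [l]:
    letting [l] tend to 0 with [e] pointing from one point of a sphere to
    another gives radial symmetry, and strict positivity of the gaps gives
    strict monotonicity along rays.

    A gap [w] is antisymmetric under the reflection, so its fractional
    Laplacian at a point [x] of Sigma can be computed by pairing [y] with its
    mirror image. If [w x <= 0] is a minimum of [w] over Sigma, all the paired
    contributions are nonpositive, because [y] is closer to [x] than its
    mirror image is ([fraclap_reflected_le], [folded_integrand_le0]).
    Keeping only the contribution of a small box near [x] yields the two
    maximum principles that are used.
    - [narrow_region_estimate]: at such a minimum the fractional Laplacian is
      at most [K * w x], where the constant [K] tends to infinity when the
      distance from [x] to the hyperplane tends to 0.
    - [strong_maximum_principle]: if [w >= 0] on Sigma vanishes at a point of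
      Sigma but not at all of them, the fractional Laplacian at that point is
      negative.

    Since [g] decreases and the reflection moves points of Sigma towards the
    origin, the equation bounds the fractional Laplacian of the gap of [u]
    from below by [f (v (refl e l x)) - f (v x)], which is at least [-M] times
    the negative part of the gap of [v], where [M] is a Lipschitz constant
    ([fraclap_gap]). Let [A] and [B] be the depths of the negative minima of
    the two gaps. If both minima lie so close to the hyperplane that [K > M],
    then [K * A <= M * B] and [K * B <= M * A], so that [A = B = 0]
    ([no_negative_min]).

    Let [s] be the supremum of the levels [l] where some gap takes a negative
    value. By continuity the gaps at level [s] are nonnegative, hence positive
    on the closed cap off the hyperplane by the strong maximum principle
    ([gap_gt0]). By compactness the gaps at levels close to [s] are positive
    except near their own hyperplane, where [no_negative_min] applies: this
    contradicts the choice of [s] ([moving_planes]). The same argument starts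
    the procedure: for [s = 1] the closed cap is the single point [e], which
    lies on the hyperplane.

    The change of variables [y |-> refl e l y] in the integrals needs the
    invariance of Lebesgue measure under reflections in all directions, which
    is derived from translation invariance ([lebesgue_rV_isometry]). *)

(** * Lebesgue measure of boxes and translates *)

Section lebesgue_rV_facts.
Context {R : realType}.

Lemma cons_rV0 n (p : measurableTypeR R * 'rV[R]_n) :
  cons_rV p ord0 ord0 = p.1.
Proof.
transitivity (row_mx (const_mx p.1 : 'rV[R]_1) p.2 ord0 (lshift n ord0)).
  by congr (row_mx _ _ _ _); exact/val_inj.
by rewrite row_mxEl mxE.
Qed.

Lemma cons_rVS n (p : measurableTypeR R * 'rV[R]_n) j :
  cons_rV p ord0 (lift ord0 j) = p.2 ord0 j.
Proof.
transitivity (row_mx (const_mx p.1 : 'rV[R]_1) p.2 ord0 (rshift 1 j)).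
  by congr (row_mx _ _ _ _); exact/val_inj.
by rewrite row_mxEr.
Qed.

Lemma measurable_cons_rV n : measurable_fun setT (@cons_rV R n).
Proof.
apply/measurable_fun_rVP => i; case: (unliftP ord0 i) => [j|] ->.
  under eq_fun do rewrite cons_rVS.
  apply: (@measurableT_comp _ _ _ _ _ _ (fun x : 'rV[R]_n => x ord0 j)) => //.
  exact: measurable_coord.
by under eq_fun do rewrite cons_rV0; exact: measurable_fst.
Qed.

Lemma lebesgue_rVS n (A : set 'rV[R]_n.+1) :
  lebesgue_rV n.+1 A = (lebesgue_measure \x lebesgue_rV n)%E (@cons_rV R n @^-1` A).
Proof. by []. Qed.

Definition box n (c : 'rV[R]_n) (r : R) : set 'rV[R]_n :=
  [set y | forall i, `|y ord0 i - c ord0 i| < r].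

Lemma measurable_box n (c : 'rV[R]_n) r : measurable (box c r).
Proof.
rewrite (_ : box c r = \bigcap_(i in [set: 'I_n])
    ((fun y : 'rV[R]_n => y ord0 i) @^-1` ball (c ord0 i) r)); last first.
  apply/seteqP; split => y /= h i; last first.
    by have := h i I; rewrite /= /ball/= distrC.
  by move=> _; rewrite /= /ball/= distrC.
apply: fin_bigcap_measurable; first exact: finite_finset.
move=> i _; rewrite -[X in measurable X]setTI; apply: measurable_coord => //.
exact: measurable_ball.
Qed.

Lemma lebesgue_rV_box n (c : 'rV[R]_n) r : 0 < r ->
  lebesgue_rV n (box c r) = ((2 * r) ^+ n)%:E.
Proof.
move=> r0; elim: n c => [|n IH] c.
  by rewrite /= diracE expr0 mem_set// => -[].
rewrite lebesgue_rVS.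
pose c' : 'rV[R]_n := \row_j c ord0 (lift ord0 j).
rewrite (_ : _ @^-1` _ = ball (c ord0 ord0) r `*` box c' r); last first.
  apply/seteqP; split => [[a x]/= h|[a x]/= [h1 h2] i].
    split; first by have := h ord0; rewrite cons_rV0 /ball/= distrC.
    by move=> j /=; have := h (lift ord0 j); rewrite cons_rVS mxE.
  case: (unliftP ord0 i) => [j|] ->; last by rewrite cons_rV0 distrC.
  by rewrite cons_rVS; have := h2 j; rewrite mxE.
rewrite product_measure1E; [|exact: measurable_ball|exact: measurable_box].
rewrite -[X in (_ * X)%E]/(lebesgue_rV n (box c' r)).
rewrite -[X in (X * _)%E]/(lebesgue_measure (ball (c ord0 ord0 : R) r)).
by rewrite IH lebesgue_measure_ball ?ltW// -EFinM exprS mulr_natl.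
Qed.

(** A translate of an interval is an interval of the same length, and
    Lebesgue measure is determined by its values on intervals. *)
Lemma lebesgue_measure_translation (a : R) (A : set (measurableTypeR R)) :
  measurable A ->
  lebesgue_measure ((fun x : measurableTypeR R => x + a) @^-1` A) =
  lebesgue_measure A.
Proof.
move=> mA.
have mt : measurable_fun setT (fun x : measurableTypeR R => x + a : measurableTypeR R).
  exact: measurable_funD.
apply/esym/(@lebesgue_measure_unique _ (pushforward lebesgue_measure
  (fun x : measurableTypeR R => x + a : measurableTypeR R))) => //.
move=> _ [[c d] _ <-]; rewrite /pushforward /=.
transitivity (lebesgue_measure (`]c - a, d - a]%classic : set (measurableTypeR R))).
  by rewrite !lebesgue_measure_itv /= !lte_fin ltrD2r -!EFinD/= opprB addrA subrK.
congr lebesgue_measure.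
by apply/seteqP; split => x /=; rewrite !in_itv/= ltrBlDr lerBrDr.
Qed.

Lemma measurable_translation n (a : 'rV[R]_n) :
  measurable_fun setT (fun x : 'rV[R]_n => x + a).
Proof.
apply/measurable_fun_rVP => i; under eq_fun do rewrite mxE.
by apply: measurable_funD => //; exact: measurable_coord.
Qed.

(** By induction on the dimension: translating the first coordinate and the
    remaining ones separately gives a measure that agrees with the product
    measure on rectangles. *)
Lemma lebesgue_rV_translation n (a : 'rV[R]_n) (A : set 'rV[R]_n) :
  measurable A ->
  lebesgue_rV n ((fun x => x + a) @^-1` A) = lebesgue_rV n A.
Proof.
elim: n a A => [|n IH] a A mA.
  by congr lebesgue_rV; apply/seteqP; split => x /=; rewrite (thinmx0 a) addr0.
pose a0 : R := a ord0 ord0.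
pose a' : 'rV[R]_n := \row_j a ord0 (lift ord0 j).
pose tau (p : measurableTypeR R * 'rV[R]_n) : measurableTypeR R * 'rV[R]_n :=
  (p.1 + a0, p.2 + a').
have mtau : measurable_fun setT tau.
  apply/measurable_fun_pair => /=.
    by apply: measurable_funD => //; exact: measurable_fst.
  by apply: (measurableT_comp (measurable_translation a')); exact: measurable_snd.
have mcA : measurable (@cons_rV R n @^-1` A).
  by rewrite -[X in measurable X]setTI; exact: measurable_cons_rV.
rewrite !lebesgue_rVS.
have ctau p : cons_rV p + a = cons_rV (tau p).
  apply/rowP => i; rewrite [LHS]mxE; case: (unliftP ord0 i) => [j|] ->.
    by rewrite !cons_rVS /tau/= [RHS]mxE [X in _ = _ + X]mxE.
  by rewrite !cons_rV0.
have -> : @cons_rV R n @^-1` ((fun x => x + a) @^-1` A) =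
    tau @^-1` (@cons_rV R n @^-1` A).
  by apply/seteqP; split => p; rewrite /preimage /mkset ctau.
apply/esym.
apply: (@product_measure_unique _ _ _ _ _ _ _
  (pushforward (lebesgue_measure \x lebesgue_rV n)%E tau)) => // B C mB mC.
pose B' := (fun x : measurableTypeR R => x + a0) @^-1` B.
pose C' := (fun x => x + a') @^-1` C.
rewrite -[LHS]/((lebesgue_measure \x lebesgue_rV n)%E (B' `*` C')).
rewrite product_measure1E.
- by congr (_ * _)%E; [exact: lebesgue_measure_translation | exact: IH].
- rewrite -[X in measurable X]setTI.
  suff : measurable_fun setT (fun x : measurableTypeR R => x + a0 : measurableTypeR R) by exact.
  exact: measurable_funD.
- by rewrite -[X in measurable X]setTI; exact: measurable_translation.
Qed.

End lebesgue_rV_facts.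

(** * Inner product and reflections in hyperplanes *)

Section euclidean.
Context {R : realType} {n : nat}.
Implicit Types (x y z e : 'rV[R]_n) (l : R).

Definition dotp x y : R := \sum_(i < n) x ord0 i * y ord0 i.

Lemma dotpC x y : dotp x y = dotp y x.
Proof. by apply: eq_bigr => i _; rewrite mulrC. Qed.

Lemma dotpDl x y z : dotp (x + y) z = dotp x z + dotp y z.
Proof. by rewrite -big_split; apply: eq_bigr => i _; rewrite mxE mulrDl. Qed.

Lemma dotpZl a x y : dotp (a *: x) y = a * dotp x y.
Proof. by rewrite mulr_sumr; apply: eq_bigr => i _; rewrite mxE mulrA. Qed.

Lemma dotpNl x y : dotp (- x) y = - dotp x y.
Proof. by rewrite -scaleN1r dotpZl mulN1r. Qed.

Lemma dotpDr x y z : dotp z (x + y) = dotp z x + dotp z y.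
Proof. by rewrite dotpC dotpDl !(dotpC z). Qed.

Lemma dotpZr a x y : dotp x (a *: y) = a * dotp x y.
Proof. by rewrite dotpC dotpZl dotpC. Qed.

Lemma dotpNr x y : dotp x (- y) = - dotp x y.
Proof. by rewrite dotpC dotpNl dotpC. Qed.

Definition dotpE := (dotpDl, dotpDr, dotpZl, dotpZr, dotpNl, dotpNr).

Lemma dotp_ge0 x : 0 <= dotp x x.
Proof. by apply: sumr_ge0 => i _; rewrite -expr2 sqr_ge0. Qed.

Lemma enormE x : enorm x = Num.sqrt (dotp x x).
Proof. by rewrite /enorm; congr Num.sqrt; apply: eq_bigr => i _; rewrite expr2. Qed.

Lemma enorm_ge0 x : 0 <= enorm x. Proof. by rewrite enormE sqrtr_ge0. Qed.

Lemma sqr_enorm x : enorm x ^+ 2 = dotp x x.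
Proof. by rewrite enormE sqr_sqrtr ?dotp_ge0. Qed.

Lemma ler_enorm x y : (enorm x <= enorm y) = (dotp x x <= dotp y y).
Proof. by rewrite !enormE ler_psqrt ?nnegrE ?dotp_ge0. Qed.

Lemma ler_enorml x a : 0 <= a -> (enorm x <= a) = (dotp x x <= a ^+ 2).
Proof. by move=> a0; rewrite -sqr_enorm ler_sqr ?nnegrE ?enorm_ge0. Qed.

Lemma ler_enormr x a : 0 <= a -> (a <= enorm x) = (a ^+ 2 <= dotp x x).
Proof. by move=> a0; rewrite -sqr_enorm ler_sqr ?nnegrE ?enorm_ge0. Qed.

Lemma ltr_enorml x a : 0 <= a -> (enorm x < a) = (dotp x x < a ^+ 2).
Proof. by move=> a0; rewrite -sqr_enorm ltr_sqr ?nnegrE ?enorm_ge0. Qed.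

Lemma dotp_eq0 x : dotp x x = 0 -> x = 0.
Proof.
move=> x0; apply/rowP => i; rewrite mxE.
have /psumr_eq0P : (forall j, true -> 0 <= x ord0 j * x ord0 j).
  by move=> j _; rewrite -expr2 sqr_ge0.
by move=> /(_ x0 i isT)/eqP; rewrite -expr2 sqrf_eq0 => /eqP.
Qed.

Lemma enormN x : enorm (- x) = enorm x.
Proof. by rewrite !enormE !dotpE opprK. Qed.

Lemma coord_le_enorm x i : `|x ord0 i| <= enorm x.
Proof.
rewrite ler_enormr// real_normK ?num_real// /dotp (bigD1 i)//= -expr2 lerDl.
by apply: sumr_ge0 => j _; rewrite -expr2 sqr_ge0.
Qed.

Lemma dotp_le_box x r : (forall i, `|x ord0 i| <= r) -> dotp x x <= n%:R * r ^+ 2.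
Proof.
move=> xr; rewrite /dotp; apply: le_trans (_ : \sum_(i < n) r ^+ 2 <= _).
  apply: ler_sum => i _; rewrite -expr2 -[_ ^+ 2]real_normK ?num_real//.
  by rewrite lerXn2r ?nnegrE// (le_trans _ (xr i)).
by rewrite sumr_const card_ord mulr_natl.
Qed.

(** The Cauchy-Schwarz inequality against a unit vector: it amounts to
    the norm of [x - (x.e) e] being nonnegative. *)
Lemma dotp_unit_le x e : dotp e e = 1 -> dotp x e ^+ 2 <= dotp x x.
Proof.
move=> e1; have := dotp_ge0 (x - dotp x e *: e).
rewrite !dotpE e1 (dotpC e x); lra.
Qed.

(** The reflection in the hyperplane [x.e = l], for a unit vector [e]. *)
Definition refl e l x := x + (2 * (l - dotp x e)) *: e.

Section unit_vector.
Variable (e : 'rV[R]_n).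
Hypothesis e1 : dotp e e = 1.

Lemma dotp_refl l x : dotp (refl e l x) e = 2 * l - dotp x e.
Proof. rewrite /refl !dotpE e1; ring. Qed.

Lemma reflK l : involutive (refl e l).
Proof.
move=> x; rewrite {1}/refl dotp_refl /refl -addrA -scalerDl.
by rewrite (_ : 2 * _ + _ = 0) ?scale0r ?addr0//; ring.
Qed.

Lemma dotp_reflB l x y :
  dotp (refl e l x - refl e l y) (refl e l x - refl e l y) = dotp (x - y) (x - y).
Proof. rewrite /refl !dotpE e1 !(dotpC e) !(dotpC y x); ring. Qed.

Lemma enorm_reflB l x y : enorm (refl e l x - refl e l y) = enorm (x - y).
Proof. by rewrite !enormE dotp_reflB. Qed.

Lemma enorm_reflB_swap l x y : enorm (refl e l x - y) = enorm (x - refl e l y).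
Proof. by rewrite -[in LHS](reflK l y) enorm_reflB. Qed.

(** For [x] and [y] on the same side of the hyperplane, [y] is closer to [x]
    than its mirror image: all the comparisons of kernels come from this
    identity. *)
Lemma dotp_subrefl l x y :
  dotp (x - refl e l y) (x - refl e l y) =
  dotp (x - y) (x - y) + 4 * (dotp x e - l) * (dotp y e - l).
Proof. rewrite /refl !dotpE e1 !(dotpC e) !(dotpC y x); ring. Qed.

(** For [l > 0] the reflection moves the points of [x.e > l] towards the
    origin. *)
Lemma dotp_refl_refl l x :
  dotp (refl e l x) (refl e l x) = dotp x x - 4 * l * (dotp x e - l).
Proof. rewrite /refl !dotpE e1 !(dotpC e); ring. Qed.

End unit_vector.

Lemma refl_translation e l x : refl e l x = refl e 0 x + (2 * l) *: e.
Proof. by rewrite /refl -addrA -scalerDl; congr (_ + _ *: _); ring. Qed.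

Lemma refl0D e x y : refl e 0 (x + y) = refl e 0 x + refl e 0 y.
Proof.
rewrite /refl addrACA -scalerDl dotpDl; congr (_ + _ *: _); ring.
Qed.

Lemma measurable_dotp (e : 'rV[R]_n) : measurable_fun setT (fun x : 'rV[R]_n => dotp x e).
Proof.
apply: measurable_sum => i; apply: measurable_funM => //.
exact: measurable_coord.
Qed.

Lemma measurable_enormB x : measurable_fun setT (fun y : 'rV[R]_n => enorm (x - y)).
Proof.
under eq_fun do rewrite enormE.
apply: (@measurableT_comp _ _ _ _ _ _ (@Num.sqrt R)).
  by apply: continuous_measurable_fun; exact: sqrt_continuous.
apply: measurable_sum => i; under eq_fun do rewrite !mxE.
by apply: measurable_funM; apply: measurable_funB => //; exact: measurable_coord.
Qed.

Lemma measurable_refl e l : measurable_fun setT (refl e l : 'rV[R]_n -> 'rV[R]_n).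
Proof.
apply/measurable_fun_rVP => i; under eq_fun do rewrite !mxE.
apply: measurable_funD; first exact: measurable_coord.
apply: measurable_funM => //; apply: measurable_funM => //.
by apply: measurable_funB => //; exact: measurable_dotp.
Qed.

End euclidean.

(** * Reflection invariance of Lebesgue measure *)

Lemma integral_sections_exchange d1 d2 (T1 : measurableType d1) (T2 : measurableType d2)
  (R : realType) (m1 : {sigma_finite_measure set T1 -> \bar R})
  (m2 : {sigma_finite_measure set T2 -> \bar R}) (A : set (T1 * T2)) :
  measurable A ->
  (\int[m1]_x m2 (xsection A x) = \int[m2]_y m1 (ysection A y))%E.
Proof.
move=> mA; have := indic_fubini_tonelli m1 m2 mA.
by rewrite indic_fubini_tonelli_FE// indic_fubini_tonelli_GE.
Qed.

Section reflection_invariance.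
Context {R : realType} {n : nat}.
Implicit Types (x y e : 'rV[R]_n) (l : R).
Local Notation L := (lebesgue_rV n : set 'rV[R]_n -> \bar R).

Lemma measurable_preimageT d d' (T : measurableType d) (U : measurableType d')
  (f : T -> U) (A : set U) :
  measurable_fun setT f -> measurable A -> measurable (f @^-1` A).
Proof. by move=> mf mA; rewrite -[X in measurable X]setTI; exact: mf. Qed.

Lemma measurable_unit_ball : measurable (@unit_ball R n).
Proof.
rewrite (_ : unit_ball = (fun y => enorm (0 - y)) @^-1` `]-oo, 1[%classic).
  by apply: measurable_preimageT; [exact: measurable_enormB|exact: measurable_itv].
by apply/seteqP; split => x /=; rewrite in_itv/= sub0r enormN.
Qed.

(** The ball lies between two boxes. *)
Lemma lebesgue_unit_ball : (0 < L unit_ball < +oo)%E.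
Proof.
have n0 : 0 < n.+1%:R^-1 :> R by rewrite invr_gt0.
apply/andP; split.
  apply: lt_le_trans (_ : L (box 0 n.+1%:R^-1) <= _)%E.
    by rewrite lebesgue_rV_box// lte_fin exprn_gt0// mulr_gt0.
  apply: le_measure; rewrite ?inE; [exact: measurable_box|exact: measurable_unit_ball|].
  move=> x xb; rewrite /unit_ball/= ltr_enorml// expr1n.
  apply: le_lt_trans (dotp_le_box (r := n.+1%:R^-1) _) _.
    by move=> i; have := xb i; rewrite mxE subr0 => /ltW.
  rewrite exprVn -ltr_pdivlMr ?invr_gt0 ?exprn_gt0// invrK mul1r -natrX ltr_nat.
  by rewrite expnS expn1 leq_pmulr.
apply: le_lt_trans (_ : L (box 0 1) < _)%E.
  apply: le_measure; rewrite ?inE; [exact: measurable_unit_ball|exact: measurable_box|].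
  by move=> x xb i; rewrite mxE subr0; exact: le_lt_trans (coord_le_enorm _ _) xb.
by rewrite lebesgue_rV_box// ltry.
Qed.

Lemma integral_patch_cst (A : set 'rV[R]_n) (c : \bar R) : measurable A ->
  (\int[L]_x (((cst c) \_ A) x) = c * L A)%E.
Proof. by move=> mA; rewrite -integral_mkcond integral_cst. Qed.

Lemma muleI_pos_fin (b x y : \bar R) : (0 < b < +oo)%E -> (b * x = b * y)%E -> x = y.
Proof.
move=> /andP[b0 boo] bxy; have bfin : b \is a fin_num by rewrite ge0_fin_numE ?ltW.
by apply/eqP; rewrite eq_le; apply/andP; split; rewrite -(lee_pmul2l bfin b0) bxy.
Qed.

(** A Fubini argument replaces the determinant. With [B] the unit ball and
    [E1 = {(x, y) | rho x in A, y - rho x in B}], the sections at fixed [x] are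
    translates of [B], so that [E1] has measure [L B * L (rho^-1 A)]. The
    section at fixed [y], translated by [rho y], is that of
    [E2 = {(x, y) | rho x + y in A, x in B}], because [rho] preserves [B] and
    [B] is symmetric. The sections of [E2] at fixed [x] are translates of [A],
    so [E2] has measure [L A * L B], and [L B] can be cancelled. *)
Lemma lebesgue_rV_isometry (rho : 'rV[R]_n -> 'rV[R]_n) (A : set 'rV[R]_n) :
  measurable_fun setT rho -> {morph rho : x y / x + y} -> involutive rho ->
  (forall x, enorm (rho x) = enorm x) -> measurable A ->
  L (rho @^-1` A) = L A.
Proof.
move=> mrho rhoD rhoK rhoE mA.
have mB := measurable_unit_ball.
pose B : set 'rV[R]_n := unit_ball.
pose E1 : set ('rV[R]_n * 'rV[R]_n) := [set p | A (rho p.1) /\ B (p.2 - rho p.1)].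
pose E2 : set ('rV[R]_n * 'rV[R]_n) := [set p | A (rho p.1 + p.2) /\ B p.1].
have mr1 : measurable_fun setT (fun p : 'rV[R]_n * 'rV[R]_n => rho p.1).
  by apply: measurableT_comp => //; exact: measurable_fst.
have mc (f : 'rV[R]_n * 'rV[R]_n -> 'rV[R]_n) i : measurable_fun setT f ->
    measurable_fun setT (fun p => f p ord0 i).
  by move=> mf; apply: (measurableT_comp (measurable_coord i)).
have mE1 : measurable E1.
  apply: measurableI; first exact: (measurable_preimageT mr1 mA).
  apply: (measurable_preimageT (f := fun p : 'rV[R]_n * 'rV[R]_n => p.2 - rho p.1)) => //.
  apply/measurable_fun_rVP => i; under eq_fun do rewrite !mxE.
  by apply: measurable_funB; apply: mc => //; exact: measurable_snd.
have mE2 : measurable E2.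
  apply: measurableI; last exact: (measurable_preimageT measurable_fst mB).
  apply: (measurable_preimageT (f := fun p : 'rV[R]_n * 'rV[R]_n => rho p.1 + p.2)) => //.
  apply/measurable_fun_rVP => i; under eq_fun do rewrite !mxE.
  by apply: measurable_funD; apply: mc => //; exact: measurable_snd.
have F1 : (\int[L]_x L (xsection E1 x) = \int[L]_y L (ysection E1 y))%E.
  exact: (integral_sections_exchange (lebesgue_rV n) (lebesgue_rV n) mE1).
have F2 : (\int[L]_x L (xsection E2 x) = \int[L]_y L (ysection E2 y))%E.
  exact: (integral_sections_exchange (lebesgue_rV n) (lebesgue_rV n) mE2).
have X1 : (\int[L]_x L (xsection E1 x) = L B * L (rho @^-1` A))%E.
  rewrite -integral_patch_cst; last exact: measurable_preimageT.
  apply: eq_integral => x _; rewrite patchE; case: ifPn => xA.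
    suff -> : xsection E1 x = (fun y => y + - rho x) @^-1` B.
      exact: lebesgue_rV_translation.
    rewrite xsectionE; apply/seteqP; split => y /=; rewrite /E1/=; first by case.
    by move=> yB; exact: (conj (set_mem xA) yB).
  suff -> : xsection E1 x = set0 by exact: measure0.
  rewrite xsectionE -subset0 => y /= -[/= xA' _].
  by move/negP: xA; apply; exact: mem_set.
have X2 : (\int[L]_x L (xsection E2 x) = L A * L B)%E.
  rewrite -(integral_patch_cst _ mB).
  apply: eq_integral => x _; rewrite patchE; case: ifPn => xB.
    suff -> : xsection E2 x = (fun y => y + rho x) @^-1` A.
      exact: lebesgue_rV_translation.
    rewrite xsectionE; apply/seteqP; split => y /=; rewrite /E2/= (addrC y).
      by case.
    by move=> yA; exact: (conj yA (set_mem xB)).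
  suff -> : xsection E2 x = set0 by exact: measure0.
  rewrite xsectionE -subset0 => y /= -[/= _ xB'].
  by move/negP: xB; apply; exact: mem_set.
(* Translating by rho y turns y - rho x into - rho x, by additivity. *)
have Y y : L (ysection E1 y) = L (ysection E2 y).
  rewrite -(@lebesgue_rV_translation _ _ (rho y) (ysection E1 y)); last first.
    exact: measurable_ysection.
  congr lebesgue_rV; rewrite !ysectionE; apply/seteqP; split => x /=;
    rewrite /E1/E2/= rhoD rhoK opprD (addrCA y) subrr addr0;
    by rewrite /B/unit_ball/= enormN rhoE.
have : (L B * L (rho @^-1` A) = L B * L A)%E.
  rewrite -X1 F1 [RHS]muleC -X2 F2; apply: eq_integral => y _; exact: Y.
exact: (muleI_pos_fin lebesgue_unit_ball).
Qed.

Lemma lebesgue_rV_refl e l (A : set 'rV[R]_n) : dotp e e = 1 -> measurable A ->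
  L (refl e l @^-1` A) = L A.
Proof.
move=> e1 mA.
have -> : refl e l @^-1` A = refl e 0 @^-1` ((fun x => x + (2 * l) *: e) @^-1` A).
  by apply/seteqP; split => x; rewrite /preimage /mkset (refl_translation e l x).
rewrite lebesgue_rV_isometry.
- exact: lebesgue_rV_translation.
- exact: measurable_refl.
- exact: refl0D.
- exact: reflK.
- by move=> x; rewrite !enormE dotp_refl_refl// mulr0 mul0r subr0.
- by apply: measurable_preimageT => //; exact: measurable_translation.
Qed.

Lemma ge0_integral_refl e l (D : set 'rV[R]_n) (f : 'rV[R]_n -> \bar R) :
  dotp e e = 1 -> measurable D -> measurable_fun D f ->
  {in D, forall y, 0 <= f y}%E ->
  (\int[L]_(x in refl e l @^-1` D) f (refl e l x) = \int[L]_(x in D) f x)%E.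
Proof.
move=> e1 mD mf f0; have mr := measurable_refl e l.
rewrite -[LHS](@ge0_integral_pushforward _ _ _ _ _ _ mr L D f)//.
apply: eq_measure_integral => A mA _.
exact: (lebesgue_rV_refl l e1 mA).
Qed.

Lemma measurable_fun_refl e l (D : set 'rV[R]_n) d (U : measurableType d) (f : 'rV[R]_n -> U) :
  measurable D -> measurable_fun D f ->
  measurable_fun (refl e l @^-1` D) (f \o refl e l).
Proof.
move=> mD mf; apply: (measurable_comp mD _ mf); first by move=> _ [x Dx <-].
by apply: measurable_funTS; exact: measurable_refl.
Qed.

Lemma integrable_refl e l (D : set 'rV[R]_n) (f : 'rV[R]_n -> \bar R) :
  dotp e e = 1 -> measurable D -> (lebesgue_rV n).-integrable D f ->
  (lebesgue_rV n).-integrable (refl e l @^-1` D) (f \o refl e l).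
Proof.
move=> e1 mD /integrableP[mf foo]; apply/integrableP; split.
  exact: measurable_fun_refl.
rewrite (@ge0_integral_refl e l D (fun x => `|f x|%E))//.
by apply: measurableT_comp.
Qed.

Lemma integral_refl e l (D : set 'rV[R]_n) (f : 'rV[R]_n -> \bar R) :
  dotp e e = 1 -> measurable D -> measurable_fun D f ->
  (\int[L]_(x in refl e l @^-1` D) (f \o refl e l) x = \int[L]_(x in D) f x)%E.
Proof.
move=> e1 mD mf; rewrite [LHS]integralE [RHS]integralE.
rewrite funepos_comp funeneg_comp.
congr (_ - _)%E.
  apply: (@ge0_integral_refl e l D (f^\+)%E e1 mD (measurable_funepos mf)).
  by move=> y _; exact: funepos_ge0.
apply: (@ge0_integral_refl e l D (f^\-)%E e1 mD (measurable_funeneg mf)).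
by move=> y _; exact: funeneg_ge0.
Qed.

End reflection_invariance.

(** * The fractional Laplacian under a reflection *)

Lemma Rintegral_le_subset d (T : measurableType d) (R : realType)
    (mu : {measure set T -> \bar R}) (S Q : set T) (h : T -> R) (c : R) :
  measurable S -> measurable Q -> Q `<=` S -> (mu Q < +oo)%E ->
  mu.-integrable S (EFin \o h) -> (forall y, S y -> h y <= 0) ->
  (forall y, Q y -> h y <= c) -> \int[mu]_(y in S) h y <= c * fine (mu Q).
Proof.
move=> mS mQ QS Qoo ih h0 hc; have mSQ : measurable (S `\` Q) by exact: measurableD.
have SE : S = Q `|` (S `\` Q) by rewrite setDUK.
rewrite SE Rintegral_setU -?SE//; last by apply/disj_setPS => y [? []].
rewrite -[leRHS]addr0 lerD//.
  rewrite -Rintegral_cst//; apply: le_Rintegral => //.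
    exact: integrableS ih.
  apply/integrableP; split; first exact: measurable_cst.
  by rewrite /= integral_cst// lte_mul_pinfty// lee_fin.
rewrite -(mul0r (fine (mu (S `\` Q)))) -Rintegral_cst//; apply: le_Rintegral => //.
- by apply: integrableS ih => // y [].
- exact: integrable0.
- by move=> y [Sy _]; exact: h0.
Qed.

Section fractional_laplacian_reflection.
Context {R : realType} {n : nat}.
Implicit Types (x y e : 'rV[R]_n) (l alpha : R) (w : 'rV[R]_n -> R).
Local Notation L := (lebesgue_rV n : set 'rV[R]_n -> \bar R).

(** The domain of the truncated integrals that define the principal value. *)
Definition away x (r : R) : set 'rV[R]_n := [set y | r <= enorm (x - y)].

Lemma measurable_away x r : measurable (away x r).
Proof.
rewrite (_ : away x r = (fun y => enorm (x - y)) @^-1` `[r, +oo[%classic).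
  by apply: measurable_preimageT; [exact: measurable_enormB|exact: measurable_itv].
by apply/seteqP; split => y; rewrite /away/= in_itv/= andbT.
Qed.

Lemma away_refl e l x r : dotp e e = 1 ->
  refl e l @^-1` away (refl e l x) r = away x r.
Proof.
by move=> e1; apply/seteqP; split => y; rewrite /preimage /away /mkset enorm_reflB.
Qed.

Lemma Rintegral_refl e l (D : set 'rV[R]_n) (f : 'rV[R]_n -> R) :
  dotp e e = 1 -> measurable D -> measurable_fun D (EFin \o f) ->
  \int[L]_(y in refl e l @^-1` D) (f \o refl e l) y = \int[L]_(y in D) f y.
Proof. by move=> e1 mD mf; exact: (congr1 fine (integral_refl l e1 mD mf)). Qed.

Lemma fraclap_integrand_refl alpha w e l x : dotp e e = 1 ->
  fraclap_integrand alpha (w \o refl e l) x =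
  fraclap_integrand alpha w (refl e l x) \o refl e l.
Proof.
by move=> e1; apply/funext => y; rewrite /fraclap_integrand/= enorm_reflB.
Qed.

Lemma is_fraclap_refl alpha w e l x k : dotp e e = 1 ->
  is_fraclap alpha w (refl e l x) k -> is_fraclap alpha (w \o refl e l) x k.
Proof.
move=> e1 [wi wk]; split.
  move=> r r0; have := integrable_refl l e1 (measurable_away (refl e l x) r) (wi _ r0).
  by rewrite (away_refl l x r e1) (fraclap_integrand_refl alpha w l x e1).
apply: cvg_trans wk; apply: near_eq_cvg; near=> r.
have r0 : 0 < r by near: r; exact: nbhs_right_gt.
have := Rintegral_refl l e1 (measurable_away (refl e l x) r)
  (measurable_int _ (wi _ r0)).
by rewrite (away_refl l x r e1) (fraclap_integrand_refl alpha w l x e1) => ->.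
Unshelve. all: by end_near. Qed.

Lemma is_fraclapB alpha w1 w2 x k1 k2 :
  is_fraclap alpha w1 x k1 -> is_fraclap alpha w2 x k2 ->
  is_fraclap alpha (fun y => w1 y - w2 y) x (k1 - k2).
Proof.
move=> [i1 c1] [i2 c2].
have E : fraclap_integrand alpha (fun y => w1 y - w2 y) x = fun y =>
    fraclap_integrand alpha w1 x y - fraclap_integrand alpha w2 x y.
  by apply/funext => y; rewrite /fraclap_integrand; ring.
split.
  move=> r r0; rewrite E.
  have := integrableB (measurable_away x r) (i1 _ r0) (i2 _ r0).
  by apply: eq_integrable; [exact: measurable_away|].
apply: cvg_trans (cvgB c1 c2); apply: near_eq_cvg; near=> r.
have r0 : 0 < r by near: r; exact: nbhs_right_gt.
rewrite E [RHS]RintegralB//; [exact: measurable_away|exact: i1|exact: i2].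
Unshelve. all: by end_near. Qed.

(** A small ball around the mirror image of [x] stays away from [x]. *)
Lemma away_opposite e l x y : dotp e e = 1 -> l < dotp x e ->
  enorm (refl e l x - y) < dotp x e - l -> dotp x e - l <= enorm (x - y).
Proof.
move=> e1 xl; rewrite ltr_enorml ?ler_enormr ?subr_ge0 ?(ltW xl)// => h.
apply: le_trans (dotp_unit_le (x - y) e1).
have := le_lt_trans (dotp_unit_le (refl e l x - y) e1) h.
rewrite (dotpDl x) (dotpDl (refl e l x)) !dotpNl dotp_refl//.
move: (dotp x e) (dotp y e) xl => a b al h2.
suff : b < l by nra.
by rewrite ltNge; apply/negP => lb; move: h2; nra.
Qed.

Lemma lebesgue_rV_small_ball x (d : R) : (0 < n)%N -> 0 < d ->
  exists2 r, 0 < r & forall A, measurable A ->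
    A `<=` [set y | enorm (x - y) < r] -> (L A < d%:E)%E.
Proof.
move=> n0 d0.
(* The enclosing box has side 2 r < 1, so its volume is at most 2 r < d. *)
pose r := Num.min 1 d / 3.
have m0 : 0 < Num.min 1 d by rewrite lt_min ltr01.
have r0 : 0 < r by rewrite divr_gt0.
exists r => // A mA AB.
apply: (@le_lt_trans _ _ (L (box x r))).
  apply: le_measure; rewrite ?inE; [exact: mA|exact: measurable_box|].
  move=> y /AB /= xyr i; rewrite distrC; apply: le_lt_trans xyr.
  by have := coord_le_enorm (x - y) i; rewrite !mxE.
rewrite lebesgue_rV_box// lte_fin.
have h1 : 2 * r <= 1.
  have : Num.min 1 d <= 1 by rewrite ge_min lexx.
  by rewrite /r; lra.
apply: le_lt_trans (_ : 2 * r < _).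
  have h0 : 0 <= 2 * r by rewrite mulr_ge0// ltW.
  by rewrite -(prednK n0) exprS; apply: ler_piMr => //; exact: exprn_ile1.
have : Num.min 1 d <= d by rewrite ge_min lexx orbT.
by rewrite /r; lra.
Qed.

(** Pairing [y] with its mirror image. Up to a set [T] close to the mirror
    image of [x], which contributes little because the integrand is integrable
    there, the truncated domain is invariant under the reflection. On the
    invariant part [S] the integral of the integrand [F] is half the integral
    of [F + F o refl], and the latter is at most its integral over [Q]. *)
Lemma fraclap_reflected_le alpha w x k e l (Q : set 'rV[R]_n) (r c : R) :
  (0 < n)%N -> dotp e e = 1 -> l < dotp x e -> is_fraclap alpha w x k ->
  (forall y, fraclap_integrand alpha w x y +
             fraclap_integrand alpha w x (refl e l y) <= 0) ->
  measurable Q -> (L Q < +oo)%E -> 0 < r ->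
  (forall y, Q y -> [/\ r <= enorm (x - y), r <= enorm (x - refl e l y) &
     fraclap_integrand alpha w x y +
     fraclap_integrand alpha w x (refl e l y) <= - c]) ->
  k <= - (c / 2) * fine (L Q).
Proof.
move=> n0 e1 xl [wi wk] H0 mQ Qoo r0 HQ.
set F := fraclap_integrand alpha w x in wi wk H0 HQ *; clearbody F.
pose d := dotp x e - l; have d0 : 0 < d by rewrite subr_gt0.
suff near_bound eta : 0 < eta -> \forall s \near 0^'+,
    \int[L]_(y in away x s) F y <= - (c / 2) * fine (L Q) + eta.
  apply/ler_addgt0Pr => eta eta0.
  apply: (ler_cvg_to wk (cvg_cst (- (c / 2) * fine (L Q) + eta))).
  exact: near_bound.
move=> eta0.
(* F is integrable at distance at least d from x, hence its integral over
   T, a set of small measure lying there, is small. *)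
have iFd : (lebesgue_rV n).-integrable setT (EFin \o (F \_ (away x d))).
  rewrite -restrict_EFin.
  exact: (proj1 (integrable_mkcond _ (measurable_away x d)) (wi _ d0)).
have [del [del0 small]] := integral_normr_continuous iFd eta0.
have [s0 s00 sB] := lebesgue_rV_small_ball (refl e l x) n0 del0.
near=> s.
have sgt0 : 0 < s by near: s; exact: nbhs_right_gt.
have sd : s <= d by near: s; exact: nbhs_right_le.
have sr : s <= r by near: s; exact: nbhs_right_le.
have ss0 : s <= s0 by near: s; exact: nbhs_right_le.
pose A := away x s.
pose S := A `&` refl e l @^-1` A.
pose T := A `\` refl e l @^-1` A.
have mA : measurable A by exact: measurable_away.
have mrA : measurable (refl e l @^-1` A).
  by apply: measurable_preimageT => //; exact: measurable_refl.
have mS : measurable S by exact: measurableI.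
have mT : measurable T by exact: measurableD.
have AST : A = S `|` T by rewrite setUIDK.
have TB : T `<=` [set y | enorm (refl e l x - y) < s].
  move=> y [_] /= /negP; rewrite -ltNge => h.
  by rewrite enorm_reflB_swap.
have Td : T `<=` away x d.
  move=> y /TB /= h; apply: away_opposite => //; exact: lt_le_trans h sd.
have iA : (lebesgue_rV n).-integrable A (EFin \o F) by exact: wi.
have iS : (lebesgue_rV n).-integrable S (EFin \o F).
  by apply: integrableS iA => // y [].
have iT : (lebesgue_rV n).-integrable T (EFin \o F).
  by apply: integrableS iA => // y [].
rewrite -/A AST Rintegral_setU -?AST//; last first.
  by apply/disj_setPS => y [[_ ?] [_]].
apply: lerD.
  have Srefl : refl e l @^-1` S = S.
    by apply/seteqP; split => y; rewrite /S /= reflK// => -[].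
  have iSr : (lebesgue_rV n).-integrable S (EFin \o (F \o refl e l)).
    by have := integrable_refl l e1 mS iS; rewrite Srefl.
  have -> : \int[L]_(y in S) F y =
      2^-1 * \int[L]_(y in S) (F y + (F \o refl e l) y).
    rewrite (RintegralD mS iS iSr).
    have := Rintegral_refl l e1 mS (measurable_int _ iS).
    have half (z1 z2 : R) : z2 = z1 -> z1 = 2^-1 * (z1 + z2) by lra.
    by rewrite Srefl => /half.
  have QS : Q `<=` S.
    by move=> y /HQ[h1 h2 _]; split; rewrite /A /away/=; exact: le_trans sr _.
  have := @Rintegral_le_subset _ _ _ L S Q (fun y => F y + (F \o refl e l) y) (- c)
    mS mQ QS Qoo _ (fun y _ => H0 y) (fun y Qy => let: And3 _ _ h := HQ y Qy in h).
  have iH : (lebesgue_rV n).-integrable S (EFin \o (fun y => F y + (F \o refl e l) y)).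
    by have := integrableD mS iS iSr; apply: eq_integrable.
  have half (a b : R) : a <= - c * b -> 2^-1 * a <= - (c / 2) * b by lra.
  by move=> /(_ iH) /half.
have -> : \int[L]_(y in T) F y = \int[L]_(y in T) ((F \_ (away x d)) y).
  apply: eq_Rintegral => y yT; rewrite patchE mem_set//; exact: Td (set_mem yT).
apply: le_trans (ler_norm _) _.
apply: le_trans (le_normr_Rintegral _ _) _ => //.
  by apply: integrableS iFd.
apply/ltW/small => //; apply: sB => // y /TB /= h; exact: lt_le_trans h ss0.
Unshelve. all: by end_near. Qed.

End fractional_laplacian_reflection.

(** * Continuity of the integrand *)

Section continuity.
Context {R : realType} {n : nat}.
Implicit Types (x y e : 'rV[R]_n) (l : R).

Lemma cvg_dotp T (F : set_system T) {FF : Filter F} (f g : T -> 'rV[R]_n) (a b : 'rV[R]_n) :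
  f @ F --> a -> g @ F --> b -> dotp (f t) (g t) @[t --> F] --> dotp a b.
Proof.
move=> fa gb; apply: cvg_big => [|i _]; first exact: add_continuous.
have c (h : T -> 'rV[R]_n) (z : 'rV[R]_n) : h @ F --> z -> h t ord0 i @[t --> F] --> z ord0 i.
  move=> hz; apply: (@continuous_cvg _ _ _ _ _ _ (fun y : 'rV[R]_n => y ord0 i)) hz.
  exact: coord_continuous.
exact: cvgM (c _ _ fa) (c _ _ gb).
Qed.

Lemma cvg_enormB x (a : 'rV[R]_n) : enorm (x - y) @[y --> a] --> enorm (x - a).
Proof.
under eq_fun do rewrite enormE; rewrite enormE.
have ida : (y : 'rV[R]_n) @[y --> a] --> a by exact: cvg_id.
have h : (x - y) @[y --> a] --> x - a by exact: (cvgB (cvg_cst x) ida).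
exact: (cvg_comp _ _ (cvg_dotp h h) (@sqrt_continuous R (dotp (x - a) (x-a)))).
Qed.

Lemma continuous_enorm : continuous (@enorm R n).
Proof.
move=> a; have := @cvg_enormB 0 a.
by under eq_fun do rewrite sub0r enormN; rewrite sub0r enormN.
Qed.

Lemma refl_cvg T (F : set_system T) {FF : Filter F} (f : T -> R)
    (g : T -> 'rV[R]_n) e l (a : 'rV[R]_n) :
  f @ F --> l -> g @ F --> a -> refl e (f t) (g t) @[t --> F] --> refl e l a.
Proof.
move=> fl ga; have ce : (fun=> e) @ F --> e by exact: cvg_cst.
apply: (cvgD ga (cvgZ (cvgM (cvg_cst (2 : R)) (cvgB fl (cvg_dotp ga ce))) ce)).
Qed.

Lemma powR_continuous_at (p a : R) : 0 < a -> {for a, continuous (fun t : R => t `^ p)}.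
Proof.
move=> a0; apply/differentiable_continuous/derivable1_diffP.
by apply: derivable_powR; rewrite in_itv/= a0.
Qed.

Lemma nbhs_box x (P : set 'rV[R]_n) : nbhs x P -> exists2 r, 0 < r & box x r `<=` P.
Proof.
move=> /nbhs_ballP[r r0 rP]; exists r => // y yr; apply: rP.
by split=> // i j; rewrite ord1 /ball/= distrC; exact: yr.
Qed.

Lemma cvg_fraclap_integrand alpha (w : 'rV[R]_n -> R) x q :
  {for q, continuous w} -> 0 < enorm (x - q) ->
  fraclap_integrand alpha w x y @[y --> q] --> fraclap_integrand alpha w x q.
Proof.
move=> wc xq; apply: (cvgM (cvgB (cvg_cst (w x)) wc)).
have pc := cvg_comp _ _ (@cvg_enormB x q) (@powR_continuous_at (n%:R + 2 * alpha) _ xq).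
by apply: (cvgV _ pc); rewrite gt_eqF// powR_gt0.
Qed.

End continuity.

(** * Maximum principles for antisymmetric functions *)

Lemma ler_inv_powR (R : realType) (a b q : R) : 0 < q -> 0 < a -> a <= b ->
  (b `^ q)^-1 <= (a `^ q)^-1.
Proof.
move=> q0 a0 ab; have b0 := lt_le_trans a0 ab.
rewrite lef_pV2 ?posrE ?powR_gt0//.
by apply: ge0_ler_powR; rewrite ?nnegrE //; exact: ltW.
Qed.

Lemma ltr_inv_powR (R : realType) (a b q : R) : 0 < q -> 0 < a -> a < b ->
  (b `^ q)^-1 < (a `^ q)^-1.
Proof.
move=> q0 a0 ab; have b0 := lt_trans a0 ab.
rewrite ltf_pV2 ?posrE ?powR_gt0//.
by apply: gt0_ltr_powR; rewrite ?nnegrE //; exact: ltW.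
Qed.

Section antisymmetric_estimates.
Context {R : realType} {n : nat}.
Variables (e : 'rV[R]_n) (l alpha : R) (w : 'rV[R]_n -> R).
Hypotheses (n0 : (0 < n)%N) (e1 : dotp e e = 1) (alpha0 : 0 < alpha).
Hypothesis wN : forall y, w (refl e l y) = - w y.
Implicit Types (x y : 'rV[R]_n).

Local Notation s := (refl e l).
Local Notation p := (n%:R + 2 * alpha).

Lemma exponent_gt0 : 0 < p.
Proof. by rewrite ltr_wpDl// ?mulr_gt0. Qed.

Lemma enorm_le_refl x y : l <= dotp x e -> l <= dotp y e ->
  enorm (x - y) <= enorm (x - s y).
Proof.
move=> xl yl; rewrite ler_enorm dotp_subrefl// lerDl.
by rewrite mulr_ge0 ?subr_ge0// mulr_ge0 ?subr_ge0.
Qed.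

Lemma kernel_le_refl x y : l <= dotp x e -> l <= dotp y e -> y != x ->
  (enorm (x - s y) `^ p)^-1 <= (enorm (x - y) `^ p)^-1.
Proof.
move=> xl yl yx.
have xy0 : 0 < enorm (x - y).
  rewrite enormE sqrtr_gt0 lt_neqAle dotp_ge0 andbT eq_sym.
  by apply: contra yx => /eqP/dotp_eq0/eqP; rewrite subr_eq0 eq_sym.
exact: (ler_inv_powR exponent_gt0 xy0 (enorm_le_refl xl yl)).
Qed.

(** By antisymmetry the two paired terms are [(w x - w y) k1] and
    [(w x + w y) k2], where [k1 >= k2 >= 0] are the kernels at [y] and at its
    mirror image; as [w x <= w y], replacing [k1] by [k2] only increases the
    first one. *)
Lemma folded_integrand_le x y : l <= dotp x e -> l <= dotp y e -> y != x ->
  w x <= w y ->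
  fraclap_integrand alpha w x y + fraclap_integrand alpha w x (s y) <=
    2 * w x / enorm (x - s y) `^ p.
Proof.
move=> xl yl yx wxy; rewrite /fraclap_integrand wN opprK.
have fold (a b k1 k2 : R) : a <= b -> k2 <= k1 ->
    (a - b) * k1 + (a + b) * k2 <= 2 * a * k2 by move=> *; nra.
exact: (fold _ _ _ _ wxy (kernel_le_refl xl yl yx)).
Qed.

(** On the far side of the hyperplane the same two terms are paired; on the
    hyperplane [w] vanishes by antisymmetry. *)
Lemma folded_integrand_le0 x y : l < dotp x e -> w x <= 0 ->
  (forall z, l < dotp z e -> w x <= w z) ->
  fraclap_integrand alpha w x y + fraclap_integrand alpha w x (s y) <= 0.
Proof.
move=> xl wx wmin.
have wmin' z : l <= dotp z e -> w x <= w z.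
  rewrite le_eqVlt => /orP[/eqP lz|]; last exact: wmin.
  suff : w z = 0 by move=> ->.
  have := wN z; rewrite (_ : s z = z); first lra.
  by rewrite /refl lz subrr mulr0 scale0r addr0.
have main z : l <= dotp z e ->
    fraclap_integrand alpha w x z + fraclap_integrand alpha w x (s z) <= 0.
  move=> zl; have [->|zx] := eqVneq z x.
    rewrite /fraclap_integrand subrr mul0r add0r wN opprK.
    by rewrite mulr_le0_ge0 ?invr_ge0 ?powR_ge0// -mulr2n -mulr_natl pmulr_rle0.
  apply: le_trans (folded_integrand_le (ltW xl) zl zx (wmin' _ zl)) _.
  by rewrite mulr_le0_ge0 ?invr_ge0 ?powR_ge0// pmulr_rle0.
have [yl|yl] := leP l (dotp y e); first exact: main.
have sy : l <= dotp (s y) e by rewrite dotp_refl//; lra.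
have comm (a b : R) : a + b <= 0 -> b + a <= 0 by rewrite addrC.
by apply: comm; rewrite -{2}(reflK e1 l y); exact: main.
Qed.

(** The box around [x + d e] of half-side [d / 2n], where [d] is the distance
    from [x] to the hyperplane, fits in the half-space; there the mirrored
    kernel is at least [(4d)^-p], while the volume of the box is of order
    [d^n]. *)
Lemma narrow_region_box x y (d := dotp x e - l) : 0 < d ->
  box (x + d *: e) (d / (2 * n%:R)) y ->
  [/\ l < dotp y e, d / 2 <= enorm (x - y) & enorm (x - s y) <= 4 * d].
Proof.
move=> d0 yQ.
have [h yE hi] : exists2 h, y = x + d *: e + h &
    forall i, `|h ord0 i| <= d / (2 * n%:R).
  exists (y - (x + d *: e)); first by rewrite addrC subrK.
  by move=> i; have /ltW := yQ i; rewrite !mxE.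
have n0R : 0 < n%:R :> R by rewrite ltr0n.
have hh : dotp h h <= d ^+ 2 / 4.
  apply: le_trans (dotp_le_box hi) _.
  rewrite [leLHS](_ : _ = d ^+ 2 / 4 * n%:R^-1); last by field; rewrite gt_eqF.
  by rewrite ler_piMr ?divr_ge0 ?sqr_ge0// invf_le1// ler1n.
have he : dotp h e ^+ 2 <= (d / 2) ^+ 2.
  by apply: le_trans (dotp_unit_le h e1) _; lra.
have {he} /andP[he1 he2] : - (d / 2) <= dotp h e <= d / 2.
  by rewrite -ler_norml -ler_sqr ?nnegrE ?divr_ge0 ?(ltW d0)// real_normK ?num_real.
have ye : dotp y e = dotp x e + d + dotp h e by rewrite yE !dotpE e1 mulr1.
have xy : dotp (x - y) (x - y) = d ^+ 2 + 2 * d * dotp h e + dotp h h.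
  rewrite (_ : x - y = - (d *: e + h)); last first.
    by rewrite yE -addrA opprD addrA subrr add0r.
  by rewrite !dotpE e1 (dotpC e); ring.
have ly : l < dotp y e by rewrite ye; rewrite /d in d0 he1 *; lra.
split=> //.
  rewrite ler_enormr ?divr_ge0 ?(ltW d0)//.
  apply: le_trans (dotp_unit_le (x - y) e1).
  rewrite dotpDl dotpNl ye -[leRHS]sqrrN ler_sqr ?nnegrE ?divr_ge0 ?(ltW d0)//; lra.
rewrite ler_enorml ?mulr_ge0 ?(ltW d0)// dotp_subrefl// xy ye -/d.
have -> : dotp x e + d + dotp h e - l = 2 * d + dotp h e by rewrite /d; ring.
nra.
Qed.

(** The narrow region principle: the factor of [w x] is of order
    [d^(-2 alpha)], hence large near the hyperplane. *)
Lemma narrow_region_estimate x k : l < dotp x e -> w x <= 0 ->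
  (forall z, l < dotp z e -> w x <= w z) -> is_fraclap alpha w x k ->
  k <= w x / (4 * (dotp x e - l)) `^ p * ((dotp x e - l) / n%:R) ^+ n.
Proof.
move=> xl wx wmin wk; set d := dotp x e - l.
have d0 : 0 < d by rewrite subr_gt0.
have n0R : 0 < n%:R :> R by rewrite ltr0n.
have r0 : 0 < d / (2 * n%:R) by rewrite divr_gt0// mulr_gt0.
have LQ := lebesgue_rV_box (x + d *: e) r0.
have := @fraclap_reflected_le R n alpha w x k e l (box (x + d *: e) (d / (2 * n%:R)))
  (d / 2) (- (2 * w x / (4 * d) `^ p)) n0 e1 xl wk
  (fun y => folded_integrand_le0 y xl wx wmin) (measurable_box _ _).
rewrite LQ ltry => /(_ isT); rewrite divr_gt0// => /(_ isT) main.
rewrite (_ : _ * _ = - (- (2 * w x / (4 * d) `^ p) / 2) *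
    fine ((2 * (d / (2 * n%:R))) ^+ n)%:E); last first.
  rewrite /= (_ : 2 * (d / (2 * n%:R)) = d / n%:R); last by field; rewrite gt_eqF.
  by congr (_ * _); field; rewrite gt_eqF// powR_gt0// mulr_gt0.
apply: main => y yQ; have [ly yx yx4] := narrow_region_box d0 yQ.
have yNx : y != x.
  apply: contraTneq yx => ->; rewrite subrr -ltNge.
  by rewrite enormE /dotp big1 ?sqrtr0 ?divr_gt0// => i _; rewrite mxE mul0r.
split=> //; first exact: le_trans yx (enorm_le_refl (ltW xl) (ltW ly)).
rewrite opprK; apply: le_trans (folded_integrand_le (ltW xl) (ltW ly) yNx (wmin _ ly)) _.
rewrite ler_wnM2l//; first by rewrite pmulr_rle0.
have xsy0 : 0 < enorm (x - s y).
  apply: lt_le_trans (enorm_le_refl (ltW xl) (ltW ly)).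
  by apply: lt_le_trans yx; rewrite divr_gt0.
exact: (ler_inv_powR exponent_gt0 xsy0 yx4).
Qed.

(** The paired integrand is nonpositive everywhere and, by continuity,
    bounded away from 0 on a box around [q]. *)
Lemma strong_maximum_principle x k q : continuous w -> l < dotp x e -> w x = 0 ->
  (forall z, l < dotp z e -> 0 <= w z) -> l < dotp q e -> 0 < w q ->
  is_fraclap alpha w x k -> k < 0.
Proof.
move=> wc xl wx w0 ql wq wk.
have qx : q != x by apply: contraTneq wq => ->; rewrite wx ltxx.
have xq0 : 0 < enorm (x - q).
  rewrite enormE sqrtr_gt0 lt_neqAle dotp_ge0 andbT eq_sym.
  by apply: contra qx => /eqP/dotp_eq0/eqP; rewrite subr_eq0 eq_sym.
have xsq := enorm_le_refl (ltW xl) (ltW ql); have xsq0 := lt_le_trans xq0 xsq.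
pose H y := fraclap_integrand alpha w x y + fraclap_integrand alpha w x (s y).
have Hq : H q < 0.
  rewrite /H /fraclap_integrand wN wx opprK !sub0r add0r addrC mulNr subr_lt0.
  rewrite ltr_pM2l//; apply: (ltr_inv_powR exponent_gt0 xq0).
  rewrite !enormE ltr_sqrt dotp_subrefl//.
    by rewrite ltrDl !mulr_gt0 ?subr_gt0.
  by rewrite ltr_wpDl ?dotp_ge0// !mulr_gt0 ?subr_gt0.
have scq : s y @[y --> q] --> s q.
  have idq : (y : 'rV[R]_n) @[y --> q] --> q by exact: cvg_id.
  exact: refl_cvg (cvg_cst l) idq.
have Hc : H y @[y --> q] --> H q.
  have c1 := @cvg_fraclap_integrand R n alpha w x q (wc q) xq0.
  have c2 := @cvg_fraclap_integrand R n alpha w x (s q) (wc (s q)) xsq0.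
  exact: (cvgD c1 (cvg_comp _ _ scq c2)).
have xc := @cvg_enormB R n x q.
have xsc : enorm (x - s y) @[y --> q] --> enorm (x - s q).
  exact: (cvg_comp _ _ scq (@cvg_enormB R n x (s q))).
pose r := enorm (x - q) / 2; have r0 : 0 < r by rewrite divr_gt0.
have rq : r < enorm (x - q) by rewrite /r; lra.
have : \forall y \near q, [/\ r <= enorm (x - y), r <= enorm (x - s y) & H y <= - - (H q / 2)].
  near=> y; split; near: y.
  - exact: (cvgr_ge _ xc).
  - by apply: (cvgr_ge _ xsc); exact: lt_le_trans rq xsq.
  - by apply: (cvgr_le _ Hc); lra.
move=> /nbhs_box[r' r'0 boxP].
have := @fraclap_reflected_le R n alpha w x k e l (box q r') r (- (H q / 2)) n0 e1 xl wk
  (fun y => _) (measurable_box _ _).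
rewrite lebesgue_rV_box// ltry => main.
apply: le_lt_trans (main _ isT r0 boxP) _.
  by move=> y; apply: folded_integrand_le0 => //; [rewrite wx|move=> z /w0; rewrite wx].
rewrite /= pmulr_llt0 ?exprn_gt0 ?mulr_gt0//; lra.
Unshelve. all: by end_near. Qed.

End antisymmetric_estimates.

(** * Lipschitz constants and the narrow-region constant *)

(** The hypothesis bounds the increments of [f] near every pair [(s, t)], so
    compactness of the square of the segment gives a single constant. *)
Lemma lipschitz_segment (R : realType) (f : R -> R) (C : R) :
  [locally [lipschitz f t | t in `[0%R, +oo[%classic]] ->
  exists2 M, 0 < M & forall s t, 0 <= s <= C -> 0 <= t <= C ->
    `|f s - f t| <= M * `|s - t|.
Proof.
move=> flip; pose I : set R := `[0, C]%classic.
have cI : compact (I `*` I) by apply: compact_setX; exact: segment_compact.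
pose P (M : R) (q : R * R) := (I `*` I) q -> `|f q.1 - f q.2| <= M * `|q.1 - q.2|.
have : \forall M \near +oo, (I `*` I) `<=` P M.
  apply: (iffLR (compact_near_coveringP _) cI R _ P) => q [/= q1 q2].
  have q0 : (`[0%R, +oo[%classic `*` `[0%R, +oo[%classic) q.
    by move: q1 q2; rewrite /I /= !in_itv/= !andbT => /andP[-> _] /andP[-> _].
  have [M0 HM] := @filter_ex _ (pinfty_nbhs R) _ _ (flip q q0).
  exists ([set z | (`[0%R, +oo[%classic `*` `[0%R, +oo[%classic) z ->
      `|f z.1 - f z.2| <= M0 * `|z.1 - z.2|], [set M | M0 <= M]).
    by split; [exact: HM|exact/nbhs_pinfty_ge/num_real].
  move=> [z M] /= [Hz M0M] [z1 z2].
  apply: le_trans (Hz _) _; last exact: ler_wpM2r.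
  by move: z1 z2; rewrite /I /= !in_itv/= !andbT => /andP[-> _] /andP[-> _].
move=> /pinfty_ex_gt0[M M0 MP]; exists M => // s t sC tC.
by apply: (MP (s, t)); rewrite /I /= !in_itv.
Qed.

Lemma narrow_region_constant (R : realType) (n : nat) (alpha K : R) :
  (0 < n)%N -> 0 < alpha -> 0 < K -> exists2 d0, 0 < d0 &
  forall d, 0 < d -> d < d0 ->
    K <= ((4 * d) `^ (n%:R + 2 * alpha))^-1 * (d / n%:R) ^+ n.
Proof.
move=> n0 a0 K0; have n0R : 0 < n%:R :> R by rewrite ltr0n.
have p0 : 0 < n%:R + 2 * alpha by rewrite ltr_wpDl// mulr_gt0.
(* The right-hand side equals 1 / (C d^(2 alpha)). *)
pose C : R := 4 `^ (n%:R + 2 * alpha) * n%:R ^+ n.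
have C0 : 0 < C by rewrite mulr_gt0 ?powR_gt0 ?exprn_gt0.
have CK0 : 0 < (C * K)^-1 by rewrite invr_gt0 mulr_gt0.
have aa : 0 < 2 * alpha by rewrite mulr_gt0.
exists ((C * K)^-1 `^ (2 * alpha)^-1); first exact: powR_gt0.
move=> d d0 dlt.
have dCK : d `^ (2 * alpha) <= (C * K)^-1.
  have -> : (C * K)^-1 = ((C * K)^-1 `^ (2 * alpha)^-1) `^ (2 * alpha).
    by rewrite -powRrM mulVf ?lt0r_neq0// powRr1 ?ltW.
  by apply: ge0_ler_powR; rewrite ?nnegrE ?powR_ge0// ltW.
rewrite [leRHS](_ : _ = (C * d `^ (2 * alpha))^-1).
  rewrite -[leLHS]invrK lef_pV2 ?posrE ?invr_gt0// ?mulr_gt0// ?powR_gt0 ?exprn_gt0//.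
  by rewrite mulrC -ler_pdivlMr// -(invfM K C) (mulrC K).
rewrite powRM ?ltW// (powRD (x := d)); last by rewrite (gt_eqF d0) implybT.
rewrite powR_mulrn ?ltW// exprMn exprVn /C.
by field; rewrite !gt_eqF ?powR_gt0 ?exprn_gt0.
Qed.

(** * The gap between a function and its reflection *)

Section moving_planes.
Context {R : realType} {n : nat}.
Implicit Types (x y z : 'rV[R]_n).

Definition gap (e : 'rV[R]_n) (l : R) (u : 'rV[R]_n -> R) x : R := u (refl e l x) - u x.

Definition gap_nonneg (e : 'rV[R]_n) (l : R) (u : 'rV[R]_n -> R) :=
  forall x, l < dotp x e -> 0 <= gap e l u x.

(** In the compactness arguments the plane and the point move together. *)
Lemma cvg_gap T (F : set_system T) {FF : Filter F} (e : 'rV[R]_n) (u : 'rV[R]_n -> R)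
    (f : T -> R) (h : T -> 'rV[R]_n) (l : R) (a : 'rV[R]_n) : continuous u ->
  f @ F --> l -> h @ F --> a -> gap e (f t) u (h t) @[t --> F] --> gap e l u a.
Proof.
move=> uc fl ha.
have c1 : refl e (f t) (h t) @[t --> F] --> refl e l a.
  exact: (@refl_cvg R n T F FF f h e l a fl ha).
have c2 : u (refl e (f t) (h t)) @[t --> F] --> u (refl e l a).
  exact: (cvg_comp _ _ c1 (uc (refl e l a))).
have c3 : u (h t) @[t --> F] --> u a by exact: (cvg_comp _ _ ha (uc a)).
exact: (cvgB c2 c3).
Qed.

Lemma compact_cap (e : 'rV[R]_n) (a : R) :
  compact [set x : 'rV[R]_n | enorm x <= 1 /\ a <= dotp x e].
Proof.
pose A := [set x : 'rV[R]_n | enorm x <= 1] `&` [set x : 'rV[R]_n | a <= dotp x e].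
have cA : closed A.
  apply: closedI.
    apply: (@preimage_closed _ _ (@enorm R n) [set r | r <= 1]); last exact: closed_le.
    by move=> x _; exact: continuous_enorm.
  apply: (@preimage_closed _ _ (fun x : 'rV[R]_n => dotp x e) [set r | a <= r]);
    last exact: closed_ge.
  move=> x _; have idx : (y : 'rV[R]_n) @[y --> x] --> x by exact: cvg_id.
  exact: (cvg_dotp idx (cvg_cst e)).
have cbox : compact [set v : 'rV[R]_n | forall i, v ord0 i \in `[-1, 1 : R]].
  apply: (@rV_compact _  _ (fun=> `[-1, 1 : R]%classic)) => _; exact: segment_compact.
apply: subclosed_compact cA cbox _ => v [v1 _] i.
by rewrite in_itv/= -ler_norml; exact: le_trans (coord_le_enorm v i) v1.
Qed.

Section one_function.
Variables (e : 'rV[R]_n) (l : R) (u : 'rV[R]_n -> R).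
Hypotheses (e1 : dotp e e = 1) (l0 : 0 < l).
Hypotheses (u_cont : continuous u) (u_pos : forall x, unit_ball x -> 0 < u x)
  (u_out : forall x, ~ unit_ball x -> u x = 0).

Lemma ge0_of_pos_on_ball x : 0 <= u x.
Proof. by case: (pselect (unit_ball x)) => [/u_pos/ltW|/u_out ->]. Qed.

Lemma gapN x : gap e l u (refl e l x) = - gap e l u x.
Proof. by rewrite /gap reflK// opprB. Qed.

Lemma continuous_gap : continuous (gap e l u).
Proof.
move=> a; have ida : (y : 'rV[R]_n) @[y --> a] --> a by exact: cvg_id.
exact: (cvg_gap u_cont (cvg_cst l) ida).
Qed.

Lemma gap_out_ge0 x : ~ unit_ball x -> 0 <= gap e l u x.
Proof. by move=> /u_out ux; rewrite /gap ux subr0 ge0_of_pos_on_ball. Qed.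

Lemma enorm_refl_lt x : l < dotp x e -> enorm (refl e l x) < enorm x.
Proof.
move=> lx; have h : 0 < 4 * l * (dotp x e - l) by rewrite !mulr_gt0 ?subr_gt0.
have h2 := dotp_refl_refl e1 l x.
by rewrite !enormE ltr_sqrt; have := dotp_ge0 (refl e l x); rewrite h2; lra.
Qed.

Lemma gap_sphere_gt0 x : l < dotp x e -> enorm x = 1 -> 0 < gap e l u x.
Proof.
move=> lx x1; have ux : u x = 0 by apply: u_out; rewrite /unit_ball/= x1 ltxx.
rewrite /gap ux subr0; apply: u_pos.
by rewrite /unit_ball/= -x1; exact: enorm_refl_lt.
Qed.

(** The gap is nonnegative outside the ball and vanishes on the hyperplane, so
    a negative minimum over the compact closed cap is attained inside and is
    a minimum over the whole half-space. *)
Lemma gap_nonneg_or_negative_min : gap_nonneg e l u \/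
  exists x, [/\ unit_ball x, l < dotp x e, gap e l u x < 0 &
    forall y, l < dotp y e -> gap e l u x <= gap e l u y].
Proof.
have [|/existsNP[x0 /not_implyP[lx0 /negP]]] := pselect (gap_nonneg e l u); first by left.
rewrite -ltNge => gx0; right.
have inB z : gap e l u z < 0 -> unit_ball z.
  by move=> gz; apply: contrapT => /gap_out_ge0; rewrite leNgt gz.
pose A := [set x : 'rV[R]_n | enorm x <= 1 /\ l <= dotp x e].
have Ax0 : A x0 by split; [exact/ltW/(inB _ gx0)|exact: ltW].
have [|c cA cmin] := @EVT_min_rV R n (gap e l u) A (ex_intro _ x0 Ax0) (@compact_cap e l).
  by apply: continuous_subspaceT; exact: continuous_gap.
have gc : gap e l u c < 0 by apply: le_lt_trans gx0; apply: cmin; exact: mem_set.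
have [c1 lc] := set_mem cA.
exists c; split => //; first exact: inB.
  rewrite lt_neqAle lc andbT; apply: contraTneq gc => lce.
  by rewrite /gap /refl lce subrr mulr0 scale0r addr0 subrr ltxx.
move=> y ly; have [y1|y1] := leP (enorm y) 1.
  by apply: cmin; apply: mem_set; split => //; exact: ltW.
apply/ltW/(lt_le_trans gc)/gap_out_ge0 => /=.
by rewrite /unit_ball/= => /(lt_trans y1); rewrite ltxx.
Qed.

End one_function.

End moving_planes.

(** * The equation for the gap *)

Section moving_planes_equation.
Context {R : realType} {n : nat}.
Implicit Types (x y z : 'rV[R]_n).
Variables (e : 'rV[R]_n) (alpha : R) (f : R -> R) (g u v : 'rV[R]_n -> R).
Hypotheses (n0 : (0 < n)%N) (e1 : dotp e e = 1) (alpha0 : 0 < alpha).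
Hypothesis f_incr : {in `[0%R, +oo[ &, {homo f : s t / s <= t}}.
Hypothesis g_decr : radially_decreasing_on unit_ball g.
Hypothesis u_eq : forall x, unit_ball x -> is_fraclap alpha u x (f (v x) + g x).
Hypotheses (u_cont : continuous u) (u_pos : forall x, unit_ball x -> 0 < u x)
  (u_out : forall x, ~ unit_ball x -> u x = 0).
Hypothesis v0 : forall x, 0 <= v x.

(** The gap solves the difference of the equations at the mirror image of [x]
    and at [x], where [g] is larger at the former. *)
Lemma fraclap_gap l x : 0 < l -> unit_ball x -> l < dotp x e ->
  exists2 k, is_fraclap alpha (gap e l u) x k & f (v (refl e l x)) - f (v x) <= k.
Proof.
move=> l0 Bx lx; have sx := enorm_refl_lt e1 l0 lx.
have Bsx : unit_ball (refl e l x) by exact: lt_trans sx Bx.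
exists (f (v (refl e l x)) + g (refl e l x) - (f (v x) + g x)).
  exact: (is_fraclapB (is_fraclap_refl e1 (u_eq Bsx)) (u_eq Bx)).
have := g_decr (mem_set Bsx) (mem_set Bx) (ltW sx); lra.
Qed.

Lemma f_incr_along x y : v x <= v y -> f (v x) <= f (v y).
Proof. by move=> h; apply: f_incr; rewrite ?in_itv/= ?v0. Qed.

(** For [K > 0], which holds close to the hyperplane, a negative minimum of the
    gap of [u] forces a negative value of the gap of [v], comparable in size. *)
Lemma negative_min_estimate l x (M K : R) :
  (forall y z, `|f (v y) - f (v z)| <= M * `|v y - v z|) ->
  0 < l -> unit_ball x -> l < dotp x e -> gap e l u x < 0 ->
  (forall y, l < dotp y e -> gap e l u x <= gap e l u y) ->
  K <= ((4 * (dotp x e - l)) `^ (n%:R + 2 * alpha))^-1 *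
       ((dotp x e - l) / n%:R) ^+ n ->
  K * - gap e l u x <= M * Num.max 0 (- gap e l v x).
Proof.
move=> fM l0 Bx lx gx gmin hK.
have [k wk fk] := fraclap_gap l0 Bx lx.
have := narrow_region_estimate n0 e1 alpha0 (gapN l u e1) lx (ltW gx) gmin wk.
rewrite -mulrA => kle.
have kK : k <= gap e l u x * K by apply: le_trans kle _; rewrite ler_wnM2l// ltW.
suff : - (M * Num.max 0 (- gap e l v x)) <= f (v (refl e l x)) - f (v x) by lra.
have := fM (refl e l x) x; rewrite /gap opprB.
have [h|h] := leP (v x) (v (refl e l x)).
  have := f_incr_along h; rewrite max_l ?subr_le0// mulr0 oppr0; lra.
rewrite max_r ?subr_ge0 ?(ltW h)// => /ler_normlP[+ _].
by rewrite ltr0_norm ?subr_lt0// opprB; lra.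
Qed.

(** On the sphere the gap is positive since [u] vanishes there and is
    positive at the mirror image. Inside the ball, a zero of the gap would
    contradict the strong maximum principle, since the gap is positive at
    [(1 + l) e], a point outside the ball whose mirror image is inside. *)
Lemma gap_gt0 l x : 0 < l < 1 -> gap_nonneg e l u -> gap_nonneg e l v ->
  enorm x <= 1 -> l < dotp x e -> 0 < gap e l u x.
Proof.
move=> /andP[l0 l1] gu gv; rewrite le_eqVlt => /orP[/eqP x1|Bx] lx.
  exact: gap_sphere_gt0.
rewrite lt_neqAle gu// andbT eq_sym; apply/eqP => gx.
have [k wk fk] := fraclap_gap l0 Bx lx.
(* The mirror image of q is (l - 1) e. *)
pose q := (1 + l) *: e.
have qe : dotp q e = 1 + l by rewrite /q dotpZl e1 mulr1.
have lq : l < dotp q e by rewrite qe; lra.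
have Bsq : unit_ball (refl e l q).
  rewrite /unit_ball/= ltr_enorml// dotp_refl_refl// qe /q !dotpE e1; nra.
have gq : 0 < gap e l u q.
  rewrite /gap [u q]u_out ?subr0; first exact: u_pos.
  rewrite /unit_ball/= ltr_enorml// /q !dotpE e1 expr1n; nra.
have := strong_maximum_principle n0 e1 alpha0 (gapN l u e1)
  (@continuous_gap _ _ e l u u_cont) lx gx gu lq gq wk.
have := f_incr_along (_ : v x <= v (refl e l x)).
have := gv _ lx; rewrite /gap subr_ge0 => h /(_ h); lra.
Qed.

End moving_planes_equation.

(** * Moving the plane *)

Section moving_planes_continuation.
Context {R : realType} {n : nat}.
Implicit Types (x y z e : 'rV[R]_n) (u : 'rV[R]_n -> R).

Lemma gap_gt0_near e u (s a : R) : continuous u ->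
  (forall x, enorm x <= 1 -> a <= dotp x e -> 0 < gap e s u x) ->
  \forall l \near s, forall x, enorm x <= 1 -> a <= dotp x e -> 0 < gap e l u x.
Proof.
move=> uc gs; pose P (l : R) x := 0 < gap e l u x.
have H : \forall l \near s, [set x : 'rV[R]_n | enorm x <= 1 /\ a <= dotp x e] `<=` P l.
  apply: (iffLR (compact_near_coveringP _) (@compact_cap R n e a) R (nbhs s) P) => x [x1 ax].
  have c : gap e q.2 u q.1 @[q --> (nbhs x, nbhs s)] --> gap e s u x.
    have c1 : q.1 @[q --> (nbhs x, nbhs s)] --> x by exact: cvg_fst.
    have c2 : q.2 @[q --> (nbhs x, nbhs s)] --> s by exact: cvg_snd.
    exact: (cvg_gap uc c2 c1).
  exact: (cvgr_gt _ c _ (gs x x1 ax)).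
by apply: filterS H => l Hl x x1 ax; exact: Hl.
Qed.

Lemma gap_nonneg_right_limit e u (s b : R) : continuous u -> s < b ->
  (forall l, s < l < b -> gap_nonneg e l u) -> gap_nonneg e s u.
Proof.
move=> uc sb good x sx.
have c : gap e l u x @[l --> s^'+] --> gap e s u x.
  have c1 : (l : R) @[l --> s^'+] --> s by exact: cvg_within.
  exact: (cvg_gap uc c1 (cvg_cst x)).
apply: (ler_cvg_to (cvg_cst 0) c); near=> l; apply: good.
  by apply/andP; split; near: l; [exact: nbhs_right_gt|exact: nbhs_right_lt].
by near: l; exact: nbhs_right_lt.
Unshelve. all: by end_near. Qed.

End moving_planes_continuation.

Section system.
Context {R : realType} {n : nat}.
Implicit Types (x y z e : 'rV[R]_n).
Variables (alpha1 alpha2 : R) (f1 f2 : R -> R) (g1 g2 u v : 'rV[R]_n -> R).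
Hypotheses (n0 : (0 < n)%N) (alpha1_gt0 : 0 < alpha1) (alpha2_gt0 : 0 < alpha2).
Hypotheses (f1_lip : [locally [lipschitz f1 t | t in `[0%R, +oo[%classic]])
  (f2_lip : [locally [lipschitz f2 t | t in `[0%R, +oo[%classic]]).
Hypotheses (f1_incr : {in `[0%R, +oo[ &, {homo f1 : s t / s <= t}})
  (f2_incr : {in `[0%R, +oo[ &, {homo f2 : s t / s <= t}}).
Hypotheses (g1_decr : radially_decreasing_on unit_ball g1)
  (g2_decr : radially_decreasing_on unit_ball g2).
Hypotheses (u_cont : continuous u) (v_cont : continuous v).
Hypotheses (u_eq : forall x, unit_ball x -> is_fraclap alpha1 u x (f1 (v x) + g1 x))
  (v_eq : forall x, unit_ball x -> is_fraclap alpha2 v x (f2 (u x) + g2 x)).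
Hypotheses (u_pos : forall x, unit_ball x -> 0 < u x)
  (v_pos : forall x, unit_ball x -> 0 < v x)
  (u_out : forall x, ~ unit_ball x -> u x = 0)
  (v_out : forall x, ~ unit_ball x -> v x = 0).

Let u0 := ge0_of_pos_on_ball u_pos u_out.
Let v0 := ge0_of_pos_on_ball v_pos v_out.

Lemma lipschitz_on_range (f : R -> R) (w : 'rV[R]_n -> R) : continuous w ->
  (forall x, 0 <= w x) -> (forall x, ~ unit_ball x -> w x = 0) ->
  [locally [lipschitz f t | t in `[0%R, +oo[%classic]] ->
  exists2 M, 0 < M & forall y z, `|f (w y) - f (w z)| <= M * `|w y - w z|.
Proof.
move=> wc w0 wout /lipschitz_segment flip.
have [C wC] : exists C, forall x, w x <= C.
  (* The closed ball, as a closed cap for the null vector. *)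
  have A0 : [set x : 'rV[R]_n | enorm x <= 1 /\ -1 <= dotp x 0] 0.
    have d0 : dotp (0 : 'rV[R]_n) 0 = 0 by rewrite /dotp big1// => i _; rewrite mxE mul0r.
    by split; [rewrite ler_enorml// d0 expr1n|rewrite d0; lra].
  have [|c _ cmax] := @EVT_max_rV R n w _ (ex_intro _ 0 A0) (@compact_cap R n 0 (-1)).
    exact: continuous_subspaceT.
  exists (w c) => x; have [Bx|/wout ->] := pselect (unit_ball x); last exact: w0.
  apply: cmax; apply: mem_set; split; first exact: ltW.
  by rewrite /dotp big1 ?lerN10// => i _; rewrite mxE mulr0.
by have [M M0 MP] := flip C; exists M => // y z; apply: MP; rewrite w0 wC.
Qed.

(** The estimates for the two gaps combine into a contraction, as soon as
    the negative values of both are located near the hyperplane. *)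
Lemma no_negative_min e l (M K d0 : R) : dotp e e = 1 -> 0 < l -> 0 < M -> M < K ->
  (forall y z, `|f1 (v y) - f1 (v z)| <= M * `|v y - v z|) ->
  (forall y z, `|f2 (u y) - f2 (u z)| <= M * `|u y - u z|) ->
  (forall d, 0 < d -> d < d0 ->
    K <= ((4 * d) `^ (n%:R + 2 * alpha1))^-1 * (d / n%:R) ^+ n) ->
  (forall d, 0 < d -> d < d0 ->
    K <= ((4 * d) `^ (n%:R + 2 * alpha2))^-1 * (d / n%:R) ^+ n) ->
  (forall x, unit_ball x -> l < dotp x e -> gap e l u x < 0 -> dotp x e - l < d0) ->
  (forall x, unit_ball x -> l < dotp x e -> gap e l v x < 0 -> dotp x e - l < d0) ->
  gap_nonneg e l u /\ gap_nonneg e l v.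
Proof.
move=> e1 l0 M0 MK f1M f2M K1 K2 un vn.
have Eu x : unit_ball x -> l < dotp x e -> gap e l u x < 0 ->
    (forall y, l < dotp y e -> gap e l u x <= gap e l u y) ->
    K * - gap e l u x <= M * Num.max 0 (- gap e l v x).
  move=> Bx lx gx gmin.
  apply: (negative_min_estimate n0 e1 alpha1_gt0 f1_incr g1_decr u_eq v0 f1M l0 Bx lx gx gmin).
  by apply: K1; [rewrite subr_gt0|exact: un].
have Ev x : unit_ball x -> l < dotp x e -> gap e l v x < 0 ->
    (forall y, l < dotp y e -> gap e l v x <= gap e l v y) ->
    K * - gap e l v x <= M * Num.max 0 (- gap e l u x).
  move=> Bx lx gx gmin.
  apply: (negative_min_estimate n0 e1 alpha2_gt0 f2_incr g2_decr v_eq u0 f2M l0 Bx lx gx gmin).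
  by apply: K2; [rewrite subr_gt0|exact: vn].
have K0 := lt_trans M0 MK.
have bound (t b : R) : 0 <= b -> - b <= t -> M * Num.max 0 (- t) <= M * b.
  by move=> b0 bt; rewrite ler_pM2l// ge_max b0/= lerNl.
have [gu|[x [Bx lx gx xmin]]] := gap_nonneg_or_negative_min e l u_cont u_pos u_out;
have [gv|[y [By ly gy ymin]]] := gap_nonneg_or_negative_min e l v_cont v_pos v_out.
- by [].
- have := le_trans (Ev y By ly gy ymin) (bound _ 0 (lexx _) _).
  by rewrite oppr0 mulr0 => /(_ (gu _ ly)); rewrite pmulr_rle0// oppr_le0 leNgt gy.
- have := le_trans (Eu x Bx lx gx xmin) (bound _ 0 (lexx _) _).
  by rewrite oppr0 mulr0 => /(_ (gv _ lx)); rewrite pmulr_rle0// oppr_le0 leNgt gx.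
- have h1 : K * - gap e l u x <= M * - gap e l v y.
    apply: le_trans (Eu x Bx lx gx xmin) (bound _ _ _ _); first by rewrite oppr_ge0 ltW.
    by rewrite opprK; exact: ymin.
  have h2 : K * - gap e l v y <= M * - gap e l u x.
    apply: le_trans (Ev y By ly gy ymin) (bound _ _ _ _); first by rewrite oppr_ge0 ltW.
    by rewrite opprK; exact: xmin.
  move: h1 h2 gx gy; move: (gap e l u x) (gap e l v y) => a b h1 h2 a0 b0; nra.
Qed.

(** The plane cannot stop at a supremum [s] of bad levels, not even at
    [s = 1]. *)
Lemma moving_planes e : dotp e e = 1 ->
  forall l, 0 < l < 1 -> gap_nonneg e l u /\ gap_nonneg e l v.
Proof.
move=> e1; pose good l := gap_nonneg e l u /\ gap_nonneg e l v.
pose S : set R := [set l | 0 < l < 1 /\ ~ good l].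
have [S0|/set0P Sne] := eqVneq S set0.
  move=> l l01; apply: contrapT => bad.
  by have : S l by []; rewrite S0.
exfalso.
have Sub : has_ubound S by exists 1 => l [/andP[_ /ltW]].
have Ssup : has_sup S by [].
pose s := sup S.
have s1 : s <= 1 by apply: ge_sup => // l [/andP[_ /ltW]].
have s0 : 0 < s.
  have [l Sl] := Sne; have [/andP[l0 _] _] := Sl.
  exact: lt_le_trans l0 (ub_le_sup Sub Sl).
have above l : s < l < 1 -> good l.
  move=> /andP[sl l1]; apply: contrapT => bad.
  have Sl : S l by split=> //; rewrite (lt_trans s0 sl).
  by have := ub_le_sup Sub Sl; rewrite leNgt sl.
have pos x : enorm x <= 1 -> s < dotp x e -> 0 < gap e s u x /\ 0 < gap e s v x.
  move=> x1 sx.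
  (* For s = 1 this cap off the hyperplane is empty. *)
  have s_lt1 : s < 1.
    apply: lt_le_trans sx _.
    have := dotp_unit_le x e1; move: x1; rewrite ler_enorml// expr1n => x1 h; nra.
  have gu : gap_nonneg e s u.
    by apply: (gap_nonneg_right_limit u_cont s_lt1) => l /above[].
  have gv : gap_nonneg e s v.
    by apply: (gap_nonneg_right_limit v_cont s_lt1) => l /above[].
  have s01 : 0 < s < 1 by rewrite s0.
  split.
    exact: (gap_gt0 n0 e1 alpha1_gt0 f1_incr g1_decr u_eq u_cont u_pos u_out v0 s01 gu gv x1 sx).
  exact: (gap_gt0 n0 e1 alpha2_gt0 f2_incr g2_decr v_eq v_cont v_pos v_out u0 s01 gv gu x1 sx).
have [M1 M10 f1M] := lipschitz_on_range v_cont v0 v_out f1_lip.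
have [M2 M20 f2M] := lipschitz_on_range u_cont u0 u_out f2_lip.
pose M := M1 + M2; pose K := M + 1.
have M0 : 0 < M by rewrite addr_gt0.
have f1M' y z : `|f1 (v y) - f1 (v z)| <= M * `|v y - v z|.
  by apply: le_trans (f1M y z) _; rewrite ler_wpM2r// lerDl ltW.
have f2M' y z : `|f2 (u y) - f2 (u z)| <= M * `|u y - u z|.
  by apply: le_trans (f2M y z) _; rewrite ler_wpM2r// lerDr ltW.
have K0 : 0 < K by rewrite addr_gt0.
have [d1 d10 K1] := narrow_region_constant n0 alpha1_gt0 K0.
have [d2 d20 K2] := narrow_region_constant n0 alpha2_gt0 K0.
pose d := Num.min d1 d2; have d0 : 0 < d by rewrite lt_min d10.
have sd : s < s + d / 2 by rewrite ltrDl divr_gt0.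
(* Hence the gaps at levels near s are positive at distance d / 2 from the
   plane at level s; a bad level l is chosen there, at most d / 2 below s. *)
have near_u := @gap_gt0_near R n e u s (s + d / 2) u_cont
  (fun x hx sx => proj1 (pos x hx (lt_le_trans sd sx))).
have near_v := @gap_gt0_near R n e v s (s + d / 2) v_cont
  (fun x hx sx => proj2 (pos x hx (lt_le_trans sd sx))).
have [r r0 rP] := iffLR (nbhs_ballP _ _) (filterI near_u near_v).
have m0 : 0 < Num.min r (d / 2) by rewrite lt_min r0 divr_gt0.
have [l Sl ls] := sup_adherent m0 Ssup.
have [/andP[l0 l1] bad] := Sl; have lles := ub_le_sup Sub Sl.
have slr : s - l < r.
  have : Num.min r (d / 2) <= r by rewrite ge_min lexx.
  by move: ls; rewrite -/s; lra.
have sld : s - l < d / 2.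
  have : Num.min r (d / 2) <= d / 2 by rewrite ge_min lexx orbT.
  by move: ls; rewrite -/s; lra.
have [|Pu Pv] := rP l.
  by rewrite /ball/= ger0_norm ?subr_ge0.
apply: bad; apply: (@no_negative_min e l M K d) => //.
- by rewrite /K ltrDl.
- by move=> t t0 td; apply: K1 => //; apply: lt_le_trans td _; rewrite ge_min lexx.
- by move=> t t0 td; apply: K2 => //; apply: lt_le_trans td _; rewrite ge_min lexx orbT.
- move=> x Bx lx gx; rewrite ltNge; apply/negP => dx.
  have := Pu x (ltW Bx) _; rewrite ltNge (ltW gx) => /(_ _)/negP; apply; lra.
- move=> x Bx lx gx; rewrite ltNge; apply/negP => dx.
  have := Pv x (ltW Bx) _; rewrite ltNge (ltW gx) => /(_ _)/negP; apply; lra.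
Qed.

End system.

(** * Radial symmetry and strict monotonicity *)

Section consequences.
Context {R : realType} {n : nat}.
Implicit Types (x y z e : 'rV[R]_n).
Variable u : 'rV[R]_n -> R.
Hypothesis u_cont : continuous u.

(** Two distinct points of a sphere are mirror images of each other in a
    hyperplane through the origin, which is the limit [l -> 0]. *)
Lemma radially_symmetric_of_gap :
  (forall e, dotp e e = 1 -> forall l, 0 < l < 1 -> gap_nonneg e l u) ->
  radially_symmetric_on [set: 'rV[R]_n] u.
Proof.
move=> good.
have half x y : enorm x = enorm y -> u y <= u x.
  move=> xy; have [->//|xNy] := eqVneq x y.
  pose a := enorm (y - x).
  have a0 : 0 < a.
    rewrite /a enormE sqrtr_gt0 lt_neqAle dotp_ge0 andbT eq_sym.
    by apply: contra xNy => /eqP/dotp_eq0/eqP; rewrite subr_eq0 eq_sym.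
  have aE : a ^+ 2 = dotp (y - x) (y - x) by rewrite sqr_enorm.
  have xyE : dotp x x = dotp y y by rewrite -!sqr_enorm xy.
  pose e := a^-1 *: (y - x).
  have e1 : dotp e e = 1.
    by rewrite /e dotpZl dotpZr -aE; field; rewrite gt_eqF.
  have ye : dotp y e = a / 2.
    rewrite /e dotpZr dotpDr dotpNr.
    have -> : dotp y y + - dotp y x = a ^+ 2 / 2.
      by rewrite aE !dotpE (dotpC x y) xyE; lra.
    by field; rewrite gt_eqF.
  have ryx : refl e 0 y = x.
    rewrite /refl ye /e scalerA.
    have -> : 2 * (0 - a / 2) * a^-1 = -1 by field; rewrite gt_eqF.
    by rewrite scaleN1r opprB addrC subrK.
  have c := @gap_nonneg_right_limit R n e u 0 1 u_cont ltr01 (good e e1) y.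
  by move: c; rewrite ye /gap ryx subr_ge0; apply; rewrite divr_gt0.
by move=> x y _ _ xy; apply/eqP; rewrite eq_le !half.
Qed.

(** By symmetry both points may be put on the ray of [y]; they are exchanged
    by the reflection at the level [(|x| + |y|) / 2]. *)
Lemma radially_strictly_decreasing_of_gap :
  radially_symmetric_on [set: 'rV[R]_n] u ->
  (forall e, dotp e e = 1 -> forall l, 0 < l < 1 -> forall x, enorm x <= 1 ->
     l < dotp x e -> 0 < gap e l u x) ->
  radially_strictly_decreasing_on [set x | 0 < enorm x < 1] u.
Proof.
move=> sym pos x y; rewrite !inE => /= /andP[x0 x1] /andP[y0 y1] xy.
pose a := enorm x; pose b := enorm y.
have bE : b ^+ 2 = dotp y y by rewrite sqr_enorm.
pose e := b^-1 *: y.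
have e1 : dotp e e = 1.
  by rewrite /e dotpZl dotpZr -bE; field; rewrite gt_eqF.
have ye : dotp y e = b by rewrite /e dotpZr -bE; field; rewrite gt_eqF.
pose l := (a + b) / 2.
have l01 : 0 < l < 1 by rewrite /l /a /b; lra.
have ly : l < dotp y e by rewrite ye /l /a /b; lra.
have := pos e e1 l l01 y (ltW y1) ly; rewrite /gap subr_gt0.
suff -> : u (refl e l y) = u x by [].
apply: sym; rewrite ?inE//.
have -> : refl e l y = a *: e.
  have yb : y = b *: e by rewrite /e scalerA mulfV ?scale1r// gt_eqF.
  rewrite /refl ye [X in X + _]yb -scalerDl; congr (_ *: _).
  by rewrite /l; field.
by rewrite enormE dotpZl dotpZr e1 mulr1 -expr2 sqrtr_sqr ger0_norm// ltW.
Qed.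

End consequences.

Unset Implicit Arguments.

Theorem theorem1p3 (R : realType) (N : nat) (hN : (2 <= N)%N)
    (alpha1 alpha2 : R)
    (halpha1 : 0 < alpha1 < 1) (halpha2 : 0 < alpha2 < 1)
    (f1 f2 : R -> R)
    (f1_lip : [locally [lipschitz f1 t | t in `[0%R, +oo[%classic]])
    (f2_lip : [locally [lipschitz f2 t | t in `[0%R, +oo[%classic]])
    (f1_incr : {in `[0%R, +oo[ &, {homo f1 : s t / s <= t}})
    (f2_incr : {in `[0%R, +oo[ &, {homo f2 : s t / s <= t}})
    (g1 g2 : 'rV[R]_N -> R)
    (g1_rad : radially_symmetric_on unit_ball g1)
    (g2_rad : radially_symmetric_on unit_ball g2)
    (g1_decr : radially_decreasing_on unit_ball g1)
    (g2_decr : radially_decreasing_on unit_ball g2)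
    (u v : 'rV[R]_N -> R)
    (uv_sol : classical_solution alpha1 alpha2 f1 f2 g1 g2 u v)
    (uv_pos : forall x, unit_ball x -> 0 < u x /\ 0 < v x) :
  [/\ radially_symmetric_on [set: 'rV[R]_N] u,
      radially_symmetric_on [set: 'rV[R]_N] v,
      radially_strictly_decreasing_on [set x | 0 < enorm x < 1] u &
      radially_strictly_decreasing_on [set x | 0 < enorm x < 1] v].
Proof.
have n0 : (0 < N)%N by exact: leq_trans hN.
have /andP[a1 _] := halpha1; have /andP[a2 _] := halpha2.
have [[uc vc] u_eq v_eq uv_out] := uv_sol.
have u_pos x : unit_ball x -> 0 < u x by move=> /uv_pos[].
have v_pos x : unit_ball x -> 0 < v x by move=> /uv_pos[].
have u_out x : ~ unit_ball x -> u x = 0 by move=> /uv_out[].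
have v_out x : ~ unit_ball x -> v x = 0 by move=> /uv_out[].
have u0 := ge0_of_pos_on_ball u_pos u_out.
have v0 := ge0_of_pos_on_ball v_pos v_out.
have good := moving_planes n0 a1 a2 f1_lip f2_lip f1_incr f2_incr g1_decr g2_decr
  uc vc u_eq v_eq u_pos v_pos u_out v_out.
have u_sym : radially_symmetric_on [set: 'rV[R]_N] u.
  by apply: radially_symmetric_of_gap => // e e1 l l01; have [] := good e e1 l l01.
have v_sym : radially_symmetric_on [set: 'rV[R]_N] v.
  by apply: radially_symmetric_of_gap => // e e1 l l01; have [] := good e e1 l l01.
split=> //; apply: radially_strictly_decreasing_of_gap => // e e1 l l01 x x1 lx;
  have [gu gv] := good e e1 l l01.
- exact: (gap_gt0 n0 e1 a1 f1_incr g1_decr u_eq uc u_pos u_out v0 l01 gu gv x1 lx).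
- exact: (gap_gt0 n0 e1 a2 f2_incr g2_decr v_eq vc v_pos v_out u0 l01 gv gu x1 lx).
Qed.
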